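(* Let $\mu$ be a probability measure on $\mathbb{R}$ satisfying the standing assumptions below and $\int_{\mathbb{R}}|x|\,d\mu<+\infty$, with support interval $I$. Let $\vec X_n$ be a random vector of $n$ i.i.d. variables with law $\mu$ and let $\vec v\in(0,1)^k$ be a percentile vector. Then \[ \lim_{n\to\infty}\frac{\mathbb{E}[SC_{\vec v}(\vec X_n)]}{\mathbb{E}[SC_{opt}(\vec X_n)]}=\frac{W_1(\mu,\nu_{Q_{\vec v}})}{W_1(\mu,\nu^{(k)})}, \] where $\nu^{(k)}$ is a solution to $\min_{\lambda\in\mathcal{P}_k(\mathbb{R})}W_1(\mu,\lambda)$ and $\nu_{Q_{\vec v}}=\sum_{i=1}^k(F_\mu(z_i)-F_\mu(z_{i-1}))\delta_{F_\mu^{[-1]}(v_i)}$ with $z_i=\frac{F_\mu^{[-1]}(v_i)+F_\mu^{[-1]}(v_{i+1})}{2}$ for $1\le i\le k-1$, $z_0=\inf I$, $z_k=\sup I$.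
   Context: For $\vec x\in\mathbb{R}^n$, $\vec y\in\mathbb{R}^k$: $SC(\vec x,\vec y)=\frac1n\sum_i\min_j|x_i-y_j|$, $SC_{opt}(\vec x)=\min_{\vec y}SC(\vec x,\vec y)$. A percentile vector is $\vec v$ with $0\le v_1\le\dots\le v_k\le1$; $\mathcal{PM}_{\vec v}$ sorts the reports $x_{(1)}\le\dots\le x_{(n)}$ and places facility $j$ at $x_{(\lfloor(n-1)v_j\rfloor+1)}$; $SC_{\vec v}(\vec x)$ is the Social Cost of its output. $\mathcal{P}_k(\mathbb{R})$: probability measures $\sum_{j=1}^k\nu_j\delta_{x_j}$ ($\nu_j\ge0$, $\sum\nu_j=1$). $W_1$ is the 1-Wasserstein distance $\min_{\pi\in\Pi(\alpha,\beta)}\int|x-y|d\pi$. $F_\mu$ is the c.d.f. of $\mu$, $F_\mu^{[-1]}(t)=\inf\{x:F_\mu(x)\ge t\}$. Standing assumptions on $\mu$: absolutely continuous with density $\rho_\mu$; support an interval on whose interior $\rho_\mu>0$; $\rho_\mu$ differentiable on the support. *)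

(* Defs.v *)
From HB Require Import structures.
From mathcomp Require Import all_boot all_order all_algebra.
From mathcomp Require Import all_classical all_reals all_analysis.
Set Implicit Arguments. Unset Strict Implicit. Unset Printing Implicit Defensive.
Import Order.TTheory GRing.Theory Num.Theory.
Import numFieldNormedType.Exports.
Local Open Scope classical_set_scope.
Local Open Scope ring_scope.

Section Defs.
Variable R : realType.

Definition mindist (x : R) (y : seq R) : R :=
  \big[Num.min/ `|x - head 0 y|]_(yj <- y) `|x - yj|.

Definition SC (x y : seq R) : R :=
  (size x)%:R^-1 * \sum_(xi <- x) mindist xi y.

Definition SC_opt (k : nat) (x : seq R) : R :=
  inf [set SC x y | y in [set y : seq R | size y = k]].

(** Percentile mechanism: facility j at x_(floor((n-1) v_j) + 1) (1-based),
    i.e. at 0-based position floor((n-1) v_j) of the sorted reports. *)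
Definition PM (k : nat) (v : 'I_k -> R) (x : seq R) : seq R :=
  [seq nth 0 (sort <=%R x) `|Num.floor (((size x)%:R - 1) * v j)|%N
  | j <- enum 'I_k].

Definition SC_v (k : nat) (v : 'I_k -> R) (x : seq R) : R := SC x (PM v x).

Definition percentile_vector (k : nat) (v : 'I_k -> R) : Prop :=
  (forall i, 0 < v i < 1) /\ (forall i j : 'I_k, (i <= j)%N -> v i <= v j).

Definition cdf (mu : set R -> \bar R) (x : R) : R := fine (mu [set y : R | y <= x]).
Definition cdf_ext (mu : set R -> \bar R) (x : \bar R) : R :=
  fine (mu [set y : R | (y%:E <= x)%E]).
Definition quantile (mu : set R -> \bar R) (t : R) : R :=
  inf [set x : R | t <= cdf mu x].

Definition couplings (alpha beta : set R -> \bar R)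
  : set (probability (R * R)%type R) :=
  [set pi | forall A : set R, measurable A ->
      pi (A `*` setT) = alpha A /\ pi (setT `*` A) = beta A].

Definition W1 (alpha beta : set R -> \bar R) : \bar R :=
  ereal_inf [set (\int[pi]_z (`|z.1 - z.2|)%:E)%E | pi in couplings alpha beta].

Definition in_Pk (k : nat) (lam : set R -> \bar R) : Prop :=
  exists (w : 'I_k -> R) (x : 'I_k -> R),
    (forall j, 0 <= w j) /\ \sum_(j < k) w j = 1 /\
    forall A : set R, measurable A ->
      lam A = (\sum_(j < k) (w j)%:E * \d_(x j) A)%E.

Definition nuQ (mu : set R -> \bar R) (a b : \bar R) (k : nat) (v : 'I_k -> R)
  : set R -> \bar R :=
  let q (m : nat) : R :=
    if insub m is Some i then quantile mu (v i) else 0 in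
  let z (m : nat) : \bar R :=
    if m == 0%N then a else if (k <= m)%N then b
    else ((q m.-1 + q m) / 2)%:E in
  fun A => (\sum_(j < k)
    (cdf_ext mu (z j.+1) - cdf_ext mu (z j))%:E * \d_(q j) A)%E.

(** differentiability of f at every point of S, relative to S
    (one-sided at endpoints of an interval) *)
Definition derivable_on (f : R -> R) (S : set R) : Prop :=
  forall x, S x -> exists l : R,
    (fun h : R => h^-1 * (f (x + h) - f x)) @
      within [set h : R | h != 0 /\ S (x + h)] (nbhs (0 : R)) --> l.

End Defs.

(* Main.v *)
Require Import Defs.
From HB Require Import structures.
From mathcomp Require Import all_boot all_order all_algebra.
From mathcomp Require Import all_classical all_reals all_analysis.
From mathcomp Require Import finmap measurable_realfun lra.
Set Implicit Arguments. Unset Strict Implicit. Unset Printing Implicit Defensive.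
Import Order.TTheory GRing.Theory Num.Theory.
Import numFieldNormedType.Exports.
Local Open Scope classical_set_scope.
Local Open Scope ring_scope.

(** Everything is governed by [L y], the [mu]-mean distance to the nearest of the
    [k] points [y].  A coupling of [mu] with a measure carried by [y] costs at
    least [L y], with equality when each point is sent to its nearest element of
    [y]; hence [W1 mu (nuQ mu a b v)] is [L] at the quantiles and [W1 mu nuk] is
    the minimum of [L], which is positive because [mu] has no atom.

    Approximating the identity by a simple function in [L^1(mu)] and bounding the
    second moment of the empirical frequencies of its level sets gives a random
    variable [D], of arbitrarily small mean for large [n], that bounds
    [|1/n sum_i g (X_i) - int g dmu|] for all 1-Lipschitz [g] at once.  With
    [g = mindist ^~ y] this controls the optimal cost.  With [g] a truncated
    linear function between a neighbour of a quantile and the corresponding order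
    statistic it shows that the order statistic is within [eps + C * D] of the
    quantile, because [F_mu] crosses the level [v_j] strictly there. *)

(** * Real-valued integrals against a probability measure *)

Section real_integrals.
Context {d : measure_display} {T : measurableType d} {R : realType}.
Implicit Types (P : probability T R) (f g : T -> R).

(** The integral of a nonnegative function is a supremum over the simple functions below it, and a
    larger function has more of them. No measurability enters, so the lemma applies to social costs
    whose measurability is never established. *)
Lemma ge0_le_integral_nomeas (m : {measure set T -> \bar R}) (f g : T -> \bar R) :
  (forall x, 0 <= f x)%E -> (forall x, f x <= g x)%E ->
  (\int[m]_x f x <= \int[m]_x g x)%E.
Proof.
move=> f0 fg; rewrite !ge0_integralTE//; last by move=> x; exact: le_trans (fg x).
by apply: ereal_sup_le => _ [h hf <-]; exists h => // x; exact: le_trans (fg x).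
Qed.

Lemma integrable_Rsum P (I : Type) (s : seq I) (f : I -> T -> R) :
  (forall i, P.-integrable setT (EFin \o f i)) ->
  P.-integrable setT (EFin \o (fun x => \sum_(i <- s) f i x)).
Proof.
move=> intf; apply: (eq_integrable _ (fun x => \sum_(i <- s) (EFin \o f i) x)%E) => //.
  by move=> x _; rewrite /= sumEFin.
exact: integrable_sum.
Qed.

Lemma Rintegral_sum P (I : Type) (s : seq I) (f : I -> T -> R) :
  (forall i, P.-integrable setT (EFin \o f i)) ->
  \int[P]_x (\sum_(i <- s) f i x) = \sum_(i <- s) \int[P]_x f i x.
Proof.
move=> intf; elim: s => [|i s IH].
  by under eq_Rintegral do rewrite big_nil; rewrite Rintegral_cst// mul0r big_nil.
under eq_Rintegral do rewrite big_cons.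
by rewrite RintegralD ?IH ?big_cons//; exact: integrable_Rsum.
Qed.

Lemma integrable_cst P (c : R) : P.-integrable setT (EFin \o (fun=> c)).
Proof. exact: finite_measure_integrable_cst. Qed.

Lemma Rintegral_prob_cst P (c : R) : \int[P]_x c = c.
Proof. by rewrite Rintegral_cst// -[RHS]mulr1; congr (_ * _); exact: (congr1 fine (probability_setT P)). Qed.

Lemma integrable_RD P f g : P.-integrable setT (EFin \o f) ->
  P.-integrable setT (EFin \o g) -> P.-integrable setT (EFin \o (fun x => f x + g x)).
Proof. by move=> If Ig; apply: (eq_integrable _ ((EFin \o f) \+ (EFin \o g))%E) => //; exact: integrableD. Qed.

Lemma integrable_RB P f g : P.-integrable setT (EFin \o f) ->
  P.-integrable setT (EFin \o g) -> P.-integrable setT (EFin \o (fun x => f x - g x)).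
Proof. by move=> If Ig; apply: (eq_integrable _ ((EFin \o f) \- (EFin \o g))%E) => //; exact: integrableB. Qed.

Lemma integrable_RZ P f (c : R) : P.-integrable setT (EFin \o f) ->
  P.-integrable setT (EFin \o (fun x => c * f x)).
Proof. by move=> If; apply: (eq_integrable _ (fun x => c%:E * (EFin \o f) x)%E) => //; exact: integrableZl. Qed.

Lemma integrable_Rle P f g : measurable_fun setT f ->
  (forall x, `|f x| <= g x) -> P.-integrable setT (EFin \o g) ->
  P.-integrable setT (EFin \o f).
Proof.
move=> mf fg; apply: le_integrable => //; first exact/measurable_EFinP.
by move=> x _; rewrite /= lee_fin (le_trans (fg x))// ler_norm.
Qed.

Lemma integrable_bounded P f (M : R) : measurable_fun setT f ->
  (forall x, `|f x| <= M) -> P.-integrable setT (EFin \o f).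
Proof. by move=> mf fM; apply: (integrable_Rle mf fM); exact: integrable_cst. Qed.

Lemma measurable_integrableR P f : P.-integrable setT (EFin \o f) ->
  measurable_fun setT f.
Proof. by move=> /measurable_int/measurable_EFinP. Qed.

End real_integrals.

(** * Transfer of integrals from the sample space to the law *)

Section transfer.
Context {d : measure_display} {T : measurableType d} {R : realType}.
Variables (P : probability T R) (mu : probability R R) (X : T -> R).
Hypothesis mX : measurable_fun setT X.
Hypothesis lX : forall A, measurable A -> P (X @^-1` A) = mu A.

Lemma ge0_integral_law (g : R -> \bar R) : measurable_fun setT g ->
  (forall x, 0 <= g x)%E -> (\int[P]_w g (X w) = \int[mu]_x g x)%E.
Proof.
move=> mg g0.
have h := ge0_integral_pushforward mX P measurableT mg (fun y _ => g0 y).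
rewrite preimage_setT in h; rewrite -[LHS]h.
by apply: eq_measure_integral => A mA _; exact: lX.
Qed.

Lemma integrable_law (g : R -> R) : mu.-integrable setT (EFin \o g) ->
  P.-integrable setT (EFin \o (g \o X)).
Proof.
move=> /integrableP[mg ig]; apply/integrableP; split.
  exact: (measurableT_comp mg mX).
rewrite (ge0_integral_law (g := fun x => `|(g x)%:E|%E))//.
by have := measurableT_comp (@abse_measurable R setT) mg.
Qed.

Lemma Rintegral_law (g : R -> R) : mu.-integrable setT (EFin \o g) ->
  \int[P]_w g (X w) = \int[mu]_x g x.
Proof.
move=> ig; congr fine.
have /= h := integral_pushforward mX (measurable_int _ ig) (integrable_law ig) measurableT.
rewrite preimage_setT in h; rewrite -[LHS]h.
by apply: eq_measure_integral => A mA _; exact: lX.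
Qed.

End transfer.

(** * Deviation of empirical frequencies from probabilities *)

Section sample.
Context {d : measure_display} {T : measurableType d} {R : realType}.
Variables (P : probability T R) (mu : probability R R).
Variables (n : nat) (X : 'I_n -> T -> R).
Hypothesis mX : forall i, measurable_fun setT (X i).
Hypothesis lX : forall i A, measurable A -> P (X i @^-1` A) = mu A.
Hypothesis indX : forall B : 'I_n -> set R, (forall i, measurable (B i)) ->
  fine (P (\bigcap_(i in [set: 'I_n]) (X i @^-1` B i))) =
  \prod_(i < n) fine (P (X i @^-1` B i)).

(** The product formula is used with [A] at the indices [i] and [j] and the whole line elsewhere,
    where the factors are 1. *)
Lemma sample_pairwise_indep (i j : 'I_n) (A : set R) : measurable A -> i != j ->
  fine (P ((X i @^-1` A) `&` (X j @^-1` A))) = fine (mu A) ^+ 2.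
Proof.
move=> mA ij.
have := @indX (fun l => if (l == i) || (l == j) then A else setT).
rewrite (_ : \bigcap_(_ in _) _ = (X i @^-1` A) `&` (X j @^-1` A)); last first.
  apply/seteqP; split => [w /= h|w /= [wi wj] l _ /=].
    by split; [have := h i I|have := h j I]; rewrite /= eqxx ?orbT.
  by case: ifPn => // /orP[] /eqP ->.
move=> -> //; last by move=> l; case: ifPn.
rewrite (bigD1 i)//= eqxx/= (bigD1 j) 1?eq_sym//= eqxx orbT !lX// big1 ?mulr1 ?expr2// => l.
by move=> /andP[/negPf -> /negPf ->]/=; rewrite preimage_setT probability_setT.
Qed.

Lemma Rintegral_indic (A : set T) : measurable A -> \int[P]_w \1_A w = fine (P A).
Proof. by move=> mA; rewrite /Rintegral integral_indic// setIT. Qed.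

Local Notation p A := (fine (mu A)).

Lemma measurable_preimage_sample i A : measurable A -> measurable (X i @^-1` A).
Proof. by move=> mA; rewrite -[X in measurable X]setTI; exact: mX. Qed.

(** Off the diagonal the covariance vanishes by pairwise independence; on it, it is the Bernoulli
    variance [p (1 - p)], at most 1. *)
Lemma sample_covariance (i j : 'I_n) (A : set R) : measurable A ->
  \int[P]_w ((\1_(X i @^-1` A) w - p A) * (\1_(X j @^-1` A) w - p A)) <= (i == j)%:R.
Proof.
move=> mA.
have mi l := measurable_preimage_sample l mA.
have iI B : measurable B -> P.-integrable setT (EFin \o (\1_B : T -> R)).
  by move=> mB; exact: integrable_indic.
have p0 : 0 <= p A by rewrite fine_ge0.
have p1 : p A <= 1 by rewrite -lee_fin fineK ?probability_le1// fin_num_measure.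
under eq_Rintegral => w _.
  rewrite (_ : _ * _ = \1_((X i @^-1` A) `&` (X j @^-1` A)) w + (p A * p A)
      - (p A * \1_(X i @^-1` A) w + p A * \1_(X j @^-1` A) w)); last first.
    by rewrite indicI /=; lra.
  over.
have iIJ := iI _ (measurableI _ _ (mi i) (mi j)).
rewrite RintegralB//; last 2 first.
- by apply: integrable_RD => //; exact: integrable_cst.
- by apply: integrable_RD; apply: integrable_RZ; exact: iI.
rewrite RintegralD//; last exact: integrable_cst.
rewrite (@RintegralD _ _ _ _ _ (fun w => p A * \1_(X i @^-1` A) w))//; try by apply: integrable_RZ; exact: iI.
rewrite Rintegral_prob_cst !RintegralZl//; try exact: iI.
rewrite !Rintegral_indic//; last exact: measurableI.
rewrite !lX//.
have [<-|ij] := eqVneq i j.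
  rewrite setIid lX// mulr1n.
  by have := mulr_ge0 p0 p0; lra.
by rewrite sample_pairwise_indep// mulr0n expr2; lra.
Qed.

Definition emp_dev (A : set R) (w : T) : R :=
  n%:R^-1 * \sum_(i < n) \1_(X i @^-1` A) w - p A.

Lemma measurable_emp_dev A : measurable A -> measurable_fun setT (emp_dev A).
Proof.
move=> mA; apply: measurable_funB => //; apply: measurable_funM => //.
by apply: measurable_sum => i; apply: measurable_indic; exact: measurable_preimage_sample.
Qed.

(** When the square of the centred sum is expanded, only the [n] diagonal terms can contribute, each
    at most 1, against the factor [n^-2]. *)
Lemma emp_dev_second_moment (A : set R) : measurable A -> (0 < n)%N ->
  \int[P]_w (emp_dev A w ^+ 2) <= n%:R^-1.
Proof.
move=> mA n0.
have nR : 0 < n%:R :> R by rewrite ltr0n.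
have p0 : 0 <= p A by rewrite fine_ge0.
have p1 : p A <= 1 by rewrite -lee_fin fineK ?probability_le1// fin_num_measure.
pose Y i w : R := \1_(X i @^-1` A) w - p A.
have mY i : measurable_fun setT (Y i).
  by apply: measurable_funB => //; apply: measurable_indic; exact: measurable_preimage_sample.
have Y1 i w : `|Y i w| <= 1.
  by rewrite /Y indicE; case: (_ \in _); rewrite ler_norml /=; apply/andP; split; lra.
have iY i j : P.-integrable setT (EFin \o (fun w => Y i w * Y j w)).
  apply: (@integrable_bounded _ _ _ _ _ 1); first exact: measurable_funM.
  by move=> w; rewrite normrM mulr_ile1.
have iYs i : P.-integrable setT (EFin \o (fun w => \sum_(j < n) (Y i w * Y j w))).
  exact: integrable_Rsum.
under eq_Rintegral => w _.
  rewrite (_ : _ ^+ 2 = n%:R^-1 ^+ 2 * \sum_(i < n) \sum_(j < n) (Y i w * Y j w)); last first.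
    rewrite /emp_dev (_ : _ - _ = n%:R^-1 * \sum_(i < n) Y i w).
      by rewrite exprMn; congr (_ * _); rewrite expr2 big_distrlr.
    rewrite big_split/= sumrN sumr_const card_ord mulrBr -[p A *+ n]mulr_natl mulrA.
    by rewrite mulVf ?mul1r// gt_eqF.
  over.
rewrite RintegralZl//; last exact: integrable_Rsum.
rewrite Rintegral_sum//.
apply: (@le_trans _ _ (n%:R^-1 ^+ 2 * \sum_(i < n) 1)).
  rewrite ler_wpM2l ?sqr_ge0// ler_sum// => i _; rewrite Rintegral_sum//.
  rewrite (le_trans (ler_sum _ (fun j _ => sample_covariance i j mA)))//.
  by rewrite (bigD1 i)//= eqxx big1 ?addr0// => j /negPf; rewrite eq_sym => ->.
by rewrite sumr_const card_ord expr2 -mulrA mulVf ?mulr1// gt_eqF.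
Qed.

(* [|u| <= eta + u^2 / eta] replaces the Cauchy-Schwarz inequality. *)
Lemma emp_dev_first_moment (A : set R) (eta : R) : measurable A -> (0 < n)%N -> 0 < eta ->
  P.-integrable setT (EFin \o (fun w => `|emp_dev A w|)) /\
  \int[P]_w `|emp_dev A w| <= eta + (eta * n%:R)^-1.
Proof.
move=> mA n0 eta0.
have nR : 0 < n%:R :> R by rewrite ltr0n.
have p0 : 0 <= p A by rewrite fine_ge0.
have p1 : p A <= 1 by rewrite -lee_fin fineK ?probability_le1// fin_num_measure.
have mE := measurable_emp_dev mA.
have bE w : `|emp_dev A w| <= 1.
  have s0 : 0 <= n%:R^-1 * (\sum_(i < n) \1_(X i @^-1` A) w : R).
    by rewrite mulr_ge0 ?invr_ge0 ?ler0n// sumr_ge0.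
  have s1 : n%:R^-1 * (\sum_(i < n) \1_(X i @^-1` A) w : R) <= 1.
    rewrite mulrC ler_pdivrMr// mul1r (@le_trans _ _ (\sum_(i < n) 1))//; last first.
      by rewrite sumr_const card_ord.
    by apply: ler_sum => i _; rewrite indicE; case: (_ \in _).
  by rewrite /emp_dev ler_norml; apply/andP; split; lra.
have iE : P.-integrable setT (EFin \o (fun w => `|emp_dev A w|)).
  apply: (@integrable_bounded _ _ _ _ _ 1); first exact: measurableT_comp.
  by move=> w; rewrite normr_id.
split=> //.
have iE2 : P.-integrable setT (EFin \o (fun w => emp_dev A w ^+ 2)).
  apply: (@integrable_bounded _ _ _ _ _ 1); first exact: measurable_funX.
  by move=> w; rewrite normrX exprn_ile1.
apply: (@le_trans _ _ (\int[P]_w (eta + eta^-1 * emp_dev A w ^+ 2))).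
  apply: le_Rintegral => //; first by apply: integrable_RD; [exact: integrable_cst|exact: integrable_RZ].
  move=> w _; rewrite -real_normK ?num_real//; set u := `|_|.
  have u0 : 0 <= u by exact: normr_ge0.
  have [ule|ult] := leP u eta.
    by rewrite (le_trans ule)// lerDl mulr_ge0 ?invr_ge0 ?sqr_ge0// ltW.
  rewrite (@le_trans _ _ (eta^-1 * u ^+ 2))// ?lerDr ?(ltW eta0)//.
  by rewrite mulrC ler_pdivlMr// expr2 ler_wpM2l// ltW.
rewrite RintegralD//; [|exact: integrable_cst|exact: integrable_RZ].
rewrite RintegralZl// Rintegral_prob_cst lerD2l invfM ler_wpM2l ?invr_ge0 ?(ltW eta0)//.
exact: emp_dev_second_moment.
Qed.

End sample.

(** * 1-Lipschitz functions *)

Section lipschitz1.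
Context {R : realType}.
Implicit Types (g : R -> R) (mu : probability R R).

Definition lip1 g := forall x y, `|g x - g y| <= `|x - y|.

Lemma lip1_measurable g : lip1 g -> measurable_fun setT g.
Proof.
move=> lg; apply: continuous_measurable_fun => x; apply/cvgrPdist_le => e e0.
near=> y; apply: (le_trans (lg _ _)); near: y.
exact: (@cvgr_dist_le _ _ _ (nbhs x) _ id).
Unshelve. all: by end_near. Qed.

Lemma lip1_integrable mu g : mu.-integrable setT (EFin \o (id : R -> R)) -> lip1 g ->
  mu.-integrable setT (EFin \o g).
Proof.
move=> iid lg; apply: (@integrable_Rle _ _ _ mu _ (fun x : R => `|g 0| + `|x|)).
- exact: lip1_measurable.
- move=> x; rewrite addrC -lerBlDr (le_trans (lerB_dist _ _))//.
  by rewrite (le_trans (lg _ _))// subr0.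
- by apply: integrable_RD; [exact: integrable_cst|exact: (@integrable_norm _ _ _ mu _ id)].
Qed.

Lemma lip1Bcst g (c : R) : lip1 g -> lip1 (fun x => g x - c).
Proof. by move=> lg x y; rewrite opprB addrA addrNK. Qed.

End lipschitz1.

(** * A law of large numbers uniform over 1-Lipschitz functions *)

Section uniform_law_of_large_numbers.
Import HBSimple.
Context {d : measure_display} {T : measurableType d} {R : realType}.
Variables (P : probability T R) (mu : probability R R).
Hypothesis iid : mu.-integrable setT (EFin \o (id : R -> R)).

(** With [G] arbitrary, every composite [G \o phi] is expanded over the same level sets of [phi];
    the later bound is uniform in [g] for this reason. *)
Lemma sfun_sum_indic (phi : {sfun R >-> R}) (G : R -> R) (x : R) :
  G (phi x) = \sum_(c <- fset_set (range phi)) G c * \1_(phi @^-1` [set c]) x.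
Proof.
have fr : finite_set (range phi) by [].
rewrite (big_fsetD1 (phi x)) /=; last by rewrite in_fset_set; [apply/mem_set; exists x|].
rewrite indicE mem_set// mulr1 big1_seq ?addr0// => c /andP[_].
rewrite !inE => /andP[cx _]; rewrite indicE memNset ?mulr0//= => xc.
by move/eqP: cx; apply; rewrite xc.
Qed.

(** Replacing [x] by [phi x] inside [g] costs at most [|x - phi x|], in the sample average and in
    the integral alike. What remains is a combination of frequency deviations with coefficients
    [g c], and [|g c| <= |c|] once [g 0 = 0]. The resulting bound does not involve [g]. *)
Lemma empirical_lip1_le (n : nat) (X : 'I_n -> T -> R) (phi : {sfun R >-> R})
    (g : R -> R) (w : T) : (0 < n)%N -> lip1 g ->
  mu.-integrable setT (EFin \o phi) ->
  `|n%:R^-1 * (\sum_(i < n) g (X i w)) - \int[mu]_x g x| <=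
  n%:R^-1 * (\sum_(i < n) `|X i w - phi (X i w)|) + \int[mu]_x `|x - phi x| +
  \sum_(c <- fset_set (range phi)) `|c| * `|emp_dev mu X (phi @^-1` [set c]) w|.
Proof.
(* Subtracting [g 0] shifts the average and the integral equally, because [n] is positive and [mu]
   has mass 1. *)
move=> n0; wlog g0 : g / g 0 = 0 => [hwlog lg iphi|lg iphi].
  have := hwlog (fun x => g x - g 0); rewrite subrr => /(_ erefl (lip1Bcst _ lg) iphi).
  rewrite RintegralB//; [|exact: lip1_integrable|exact: integrable_cst].
  rewrite Rintegral_prob_cst sumrB sumr_const card_ord mulrBr -[g 0 *+ n]mulr_natl.
  rewrite (mulrA n%:R^-1) mulVf ?mul1r ?pnatr_eq0 -?lt0n//.
  by rewrite opprB addrA addrNK.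
have mphi : measurable_fun setT phi by [].
have mA c : measurable (phi @^-1` [set c]) by rewrite -[X in measurable X]setTI; exact: mphi.
have ig : mu.-integrable setT (EFin \o g) by exact: lip1_integrable.
have igphi : mu.-integrable setT (EFin \o (g \o phi)).
  apply: (@integrable_Rle _ _ _ mu _ (fun x : R => `|phi x|)).
  - by apply: measurableT_comp => //; exact: lip1_measurable.
  - by move=> x; have := lg (phi x) 0; rewrite g0 !subr0.
  - exact: (integrable_norm (f := phi)).
have idev : mu.-integrable setT (EFin \o (fun x => `|x - phi x|)).
  apply: (integrable_norm (f := fun x : R => x - phi x)).
  exact: (@integrable_RB _ _ _ mu id).
have iI c : mu.-integrable setT (EFin \o (\1_(phi @^-1` [set c]) : R -> R)).
  exact: integrable_indic.
have E1 : `|\int[mu]_x g x - \int[mu]_x g (phi x)| <= \int[mu]_x `|x - phi x|.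
  rewrite -RintegralB//.
  have iB : mu.-integrable setT (EFin \o (fun x => g x - (g \o phi) x)) by exact: integrable_RB.
  rewrite (le_trans (le_normr_Rintegral _ iB))//; apply: le_Rintegral => //.
    exact: (integrable_norm iB).
  by move=> x _; exact: lg.
have E2 : `|n%:R^-1 * (\sum_(i < n) g (X i w)) - n%:R^-1 * (\sum_(i < n) g (phi (X i w)))|
    <= n%:R^-1 * (\sum_(i < n) `|X i w - phi (X i w)|).
  rewrite -mulrBr -sumrB normrM ger0_norm ?invr_ge0// ler_wpM2l ?invr_ge0//.
  by rewrite (le_trans (ler_norm_sum _ _ _))// ler_sum.
have E3 : n%:R^-1 * (\sum_(i < n) g (phi (X i w))) - \int[mu]_x g (phi x) =
    \sum_(c <- fset_set (range phi)) g c * emp_dev mu X (phi @^-1` [set c]) w.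
  under eq_bigr do rewrite sfun_sum_indic.
  under eq_Rintegral do rewrite sfun_sum_indic.
  rewrite Rintegral_sum; last by move=> c; apply: integrable_RZ; exact: iI.
  rewrite exchange_big/= mulr_sumr -sumrB; apply: eq_bigr => c _.
  rewrite RintegralZl//.
  rewrite /emp_dev mulrBr -mulr_sumr mulrCA; congr (_ * (_ * _) - _ * _).
  by rewrite /Rintegral integral_indic// setIT.
have E4 : `|\sum_(c <- fset_set (range phi)) g c * emp_dev mu X (phi @^-1` [set c]) w| <=
    \sum_(c <- fset_set (range phi)) `|c| * `|emp_dev mu X (phi @^-1` [set c]) w|.
  rewrite (le_trans (ler_norm_sum _ _ _))// ler_sum// => c _; rewrite normrM ler_wpM2r//.
  by have := lg c 0; rewrite g0 !subr0.
rewrite -E3 in E4.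
move: E1 E2 E4; rewrite !ler_norml => /andP[? ?] /andP[? ?] /andP[? ?].
by apply/andP; split; lra.
Qed.

Variable X : forall n : nat, 'I_n -> T -> R.
Hypothesis mX : forall n (i : 'I_n), measurable_fun setT (X i).
Hypothesis lX : forall n (i : 'I_n) A, measurable A -> P (X i @^-1` A) = mu A.
Hypothesis indX : forall n (B : 'I_n -> set R), (forall i, measurable (B i)) ->
  fine (P (\bigcap_(i in [set: 'I_n]) (X i @^-1` B i))) =
  \prod_(i < n) fine (P (X i @^-1` B i)).

(** The bound of [empirical_lip1_le] serves as [D]. Its mean is made small by fixing first a simple
    function [phi] close to the identity, then a large [n]. *)
Theorem uniform_lln_lip1 (e : R) : 0 < e -> exists N : nat, forall n : nat, (N <= n)%N ->
  exists D : T -> R, [/\ forall w, 0 <= D w, P.-integrable setT (EFin \o D),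
    \int[P]_w D w <= e &
    forall w g, lip1 g ->
      `|n%:R^-1 * (\sum_(i < n) g (X i w)) - \int[mu]_x g x| <= D w].
Proof.
move=> e0.
have [phi iphi ephi] : exists2 phi : {sfun R >-> R}, mu.-integrable setT (EFin \o phi) &
    \int[mu]_x `|x - phi x| <= e / 4.
  have [g_ [ig _ cg]] := approximation_sfun_integrable measurableT iid.
  have e4 : 0 < e / 4 by rewrite divr_gt0.
  have /fine_cvgP[/= [M1 _ hM1]] := cg.
  move=> /cvgrPdist_le/(_ _ e4)[M2 _ hM2].
  exists (g_ (maxn M1 M2)) => //.
  have := hM2 (maxn M1 M2) (leq_maxr _ _).
  by rewrite /= sub0r normrN; apply: le_trans; exact: ler_norm.
pose s := fset_set (range phi).
pose K := \sum_(c <- s) `|c|.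
have K0 : 0 <= K by exact: sumr_ge0.
(* Chosen so that [K * eta <= e / 4]; the [+ 1] covers the case [K = 0]. *)
pose eta := e / (4 * (K + 1)).
have K1 : 0 < 4 * (K + 1) by rewrite mulr_gt0// ltr_wpDl.
have eta0 : 0 < eta by rewrite divr_gt0.
have Keta : K * eta <= e / 4.
  by rewrite /eta mulrA ler_pdivrMr//; lra.
(* Past [eta ^- 2] one has [(eta * n)^-1 <= eta], so each frequency deviation has mean at most
   [2 * eta]. *)
pose N := (Num.truncn (eta ^- 2)).+1.
exists N => n Nn.
have n0 : (0 < n)%N by exact: leq_trans Nn.
have nR : 0 < n%:R :> R by rewrite ltr0n.
have neta : (eta * n%:R)^-1 <= eta.
  rewrite invfM ler_pdivrMl// -expr2 -[leRHS]invrK lef_pV2 ?posrE ?invr_gt0 ?exprn_gt0//.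
  rewrite (le_trans (ltW (truncnS_gt _)))// ler_nat.
  by [].
have mphi : measurable_fun setT phi by [].
have mA c : measurable (phi @^-1` [set c]) by rewrite -[X in measurable X]setTI; exact: mphi.
have idev : mu.-integrable setT (EFin \o (fun x => `|x - phi x|)).
  apply: (integrable_norm (f := fun x : R => x - phi x)).
  exact: (@integrable_RB _ _ _ mu id).
pose D1 w := n%:R^-1 * (\sum_(i < n) `|X i w - phi (X i w)|).
pose D2 w := \sum_(c <- s) `|c| * `|emp_dev mu (X (n:=n)) (phi @^-1` [set c]) w|.
have idX (i : 'I_n) : P.-integrable setT (EFin \o (fun w => `|X i w - phi (X i w)|)).
  exact: (integrable_law (mX i) (lX i) idev).
have iD1 : P.-integrable setT (EFin \o D1).
  by apply: integrable_RZ; exact: integrable_Rsum.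
have FM c := emp_dev_first_moment (@mX n) (@lX n) (@indX n) (mA c) n0 eta0.
have iDc c : P.-integrable setT (EFin \o (fun w => `|c| * `|emp_dev mu (X (n:=n)) (phi @^-1` [set c]) w|)).
  by apply: integrable_RZ; exact: (FM c).1.
have iD2 : P.-integrable setT (EFin \o D2) by exact: integrable_Rsum.
have i3 := integrable_cst P (\int[mu]_x `|x - phi x|).
(* The three means are at most [e / 4], [e / 4] and [2 * K * eta <= e / 2]. *)
exists (fun w => D1 w + \int[mu]_x `|x - phi x| + D2 w); split.
- move=> w; rewrite !addr_ge0//.
  + by rewrite mulr_ge0 ?invr_ge0// sumr_ge0.
  + exact: Rintegral_ge0.
  + by rewrite sumr_ge0// => c _; rewrite mulr_ge0.
- by apply: integrable_RD => //; exact: integrable_RD.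
- rewrite RintegralD//; last exact: integrable_RD.
  rewrite RintegralD// Rintegral_prob_cst.
  have -> : \int[P]_w D1 w = \int[mu]_x `|x - phi x|.
    rewrite RintegralZl//; last exact: integrable_Rsum.
    rewrite Rintegral_sum//.
    rewrite (eq_bigr (fun=> \int[mu]_x `|x - phi x|)); last first.
      by move=> i _; exact: (Rintegral_law (mX i) (lX i) idev).
    by rewrite sumr_const card_ord -[X in _ * X = _]mulr_natl mulrA mulVf ?mul1r// gt_eqF.
  have : \int[P]_w D2 w <= K * (eta + eta).
    rewrite Rintegral_sum// mulr_suml ler_sum// => c _.
    rewrite RintegralZl//; last exact: (FM c).1.
    by rewrite ler_wpM2l// (le_trans (FM c).2)// lerD2l.
  by move: ephi Keta; lra.
- by move=> w g lg; exact: empirical_lip1_le.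
Qed.

End uniform_law_of_large_numbers.

(** * Distance to the nearest of finitely many points *)

Section mindist.
Context {R : realType}.
Implicit Types (x c : R) (y : seq R).

Lemma bigmin_le_mem (F : R -> R) (d0 : R) (y : seq R) c : c \in y ->
  \big[Num.min/d0]_(a <- y) F a <= F c.
Proof.
elim: y => // a y IH; rewrite inE big_cons ge_min => /predU1P[->|/IH ->].
  by rewrite lexx.
by rewrite orbT.
Qed.

Lemma bigmin_attained (F : R -> R) (d0 : R) (y : seq R) :
  \big[Num.min/d0]_(a <- y) F a = d0 \/
  exists2 c, c \in y & \big[Num.min/d0]_(a <- y) F a = F c.
Proof.
elim: y => [|a y IH]; first by left; rewrite big_nil.
rewrite big_cons; have [_|_] := leP (F a); first by right; exists a; rewrite ?mem_head.
by case: IH => [->|[c cy ->]]; [left|right; exists c; rewrite ?inE ?cy ?orbT].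
Qed.

Lemma mindist_le x y c : c \in y -> mindist x y <= `|x - c|.
Proof. exact: bigmin_le_mem. Qed.

Lemma mindist_attained x y : (0 < size y)%N ->
  exists2 c, c \in y & mindist x y = `|x - c|.
Proof.
(* The default value of the minimum is the distance to [head 0 y], itself an element of the nonempty
   [y]. *)
move=> y0; rewrite /mindist; have [->|//] := bigmin_attained (fun c => `|x - c|) `|x - head 0 y| y.
by exists (head 0 y) => //; case: y y0 => //= a y _; rewrite mem_head.
Qed.

Lemma mindist_ge0 x y : (0 < size y)%N -> 0 <= mindist x y.
Proof. by move=> /(mindist_attained x)[c _ ->]. Qed.

Lemma mindist_lip1 y : (0 < size y)%N -> lip1 (fun x => mindist x y).
Proof.
move=> y0 x x'; have h a b : mindist a y - mindist b y <= `|a - b|.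
  have [c cy ->] := mindist_attained b y0.
  rewrite lerBlDr (le_trans (mindist_le _ cy))// (_ : a - c = (a - b) + (b - c)).
    exact: ler_normD.
  by rewrite addrA addrNK.
by rewrite ler_norml lerNl opprB h distrC h.
Qed.

(** The index of the nearest point in one family gives a competitor in the other, at the cost of one
    term [|f j - f' j|]. As [j] varies with [x], the whole sum is taken as the bound. *)
Lemma mindist_dist_le (k : nat) (f f' : 'I_k -> R) x : (0 < k)%N ->
  `|mindist x [seq f j | j <- enum 'I_k] - mindist x [seq f' j | j <- enum 'I_k]| <=
  \sum_(j < k) `|f j - f' j|.
Proof.
move=> k0.
have h (g g' : 'I_k -> R) : mindist x [seq g j | j <- enum 'I_k] -
    mindist x [seq g' j | j <- enum 'I_k] <= \sum_(j < k) `|g j - g' j|.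
  have [|c /mapP[j _ ->] ->] := @mindist_attained x [seq g' j | j <- enum 'I_k].
    by rewrite size_map size_enum_ord.
  rewrite lerBlDr (@le_trans _ _ `|x - g j|)//.
    by apply: mindist_le; rewrite map_f// mem_enum.
  rewrite (_ : x - g j = (g' j - g j) + (x - g' j)); last by lra.
  rewrite (le_trans (ler_normD _ _))// lerD2r distrC (bigD1 j)//= lerDl.
  exact: sumr_ge0.
rewrite ler_norml lerNl opprB h andbT (le_trans (h _ _))//.
by rewrite ler_sum// => j _; rewrite distrC.
Qed.

End mindist.

(** * Convergence of expectations by squeezing *)

Section expectation_limit.
Context {d : measure_display} {T : measurableType d} {R : realType}.

(* The integral is monotone on nonnegative functions even when they are not
   measurable, so squeezing [f n] between integrable functions is enough. *)
Lemma cvg_expectation_squeeze (P : probability T R) (f : nat -> T -> R) (c : R) :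
  0 <= c -> (forall n w, 0 <= f n w) ->
  (forall e, 0 < e -> exists N, forall n, (N <= n)%N -> exists D : T -> R,
    [/\ forall w, 0 <= D w, P.-integrable setT (EFin \o D), \int[P]_w D w <= e &
        forall w, `|f n w - c| <= D w]) ->
  fine (\int[P]_w (f n w)%:E)%E @[n --> \oo] --> c.
Proof.
move=> c0 f0 h; apply/cvgrPdist_le => e e0.
have [N hN] := h e e0; exists N => // n /= Nn.
have [D [D0 iD De fD]] := hN n Nn.
have ic := integrable_cst P c.
have up : (\int[P]_w (f n w)%:E <= (c + \int[P]_w D w)%:E)%E.
  have icD := integrable_RD ic iD.
  rewrite -[c](Rintegral_prob_cst P) -RintegralD// fineK; last exact: integrable_fin_num.
  apply: ge0_le_integral_nomeas => w; first by rewrite lee_fin.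
  by have := fD w; rewrite lee_fin ler_norml => /andP[_]; lra.
have lo : ((c - \int[P]_w D w)%:E <= \int[P]_w (f n w)%:E)%E.
  have icD := integrable_RB ic iD.
  (* Truncation at 0 gives the nonnegative minorant that [ge0_le_integral_nomeas] requires. *)
  pose g w := Num.max (c - D w) 0.
  have ig : P.-integrable setT (EFin \o g).
    apply: (@integrable_Rle _ _ _ _ _ (fun=> c)) => //.
      apply: measurable_maxr => //; exact: (measurable_integrableR icD).
    by move=> w; rewrite /g ger0_norm ?le_max ?lexx ?orbT// ge_max c0 andbT lerBlDr lerDl.
  apply: (@le_trans _ _ (\int[P]_w (g w)%:E)%E).
    rewrite -[leRHS]fineK; last exact: integrable_fin_num.
    rewrite lee_fin -[c](Rintegral_prob_cst P) -RintegralB//.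
    by apply: le_Rintegral => // w _; rewrite /g le_max lexx.
  apply: ge0_le_integral_nomeas => w; first by rewrite lee_fin /g le_max lexx orbT.
  rewrite lee_fin /g ge_max f0 andbT.
  by have := fD w; rewrite ler_norml => /andP[+ _]; lra.
have fin : (\int[P]_w (f n w)%:E)%E \is a fin_num.
  rewrite ge0_fin_numE; first by rewrite (le_lt_trans up)// ltry.
  by apply: integral_ge0 => w _; rewrite lee_fin.
rewrite -(fineK fin) !lee_fin in up lo.
by rewrite ler_norml; apply/andP; split; lra.
Qed.

End expectation_limit.

(** * Sums bounded below through an order statistic *)

Section order_statistics.
Context {R : realType}.
Variables (x : seq R) (m : nat) (g : R -> R) (t : R).
Local Notation s := (sort <=%R x).
Hypothesis mx : (m < size x)%N.
Hypothesis g0 : forall z, 0 <= g z.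

Let sum_sort : \sum_(z <- x) g z = \sum_(0 <= i < m) g (nth 0 s i) +
  \sum_(m <= i < size x) g (nth 0 s i).
Proof.
rewrite -big_cat_nat//=; last exact: ltnW.
rewrite -(size_sort <=%R x) -(big_nth _ xpredT); apply: perm_big.
by rewrite perm_sym; apply/permPl/perm_sort.
Qed.

Let sorted_s i j : (i <= j < size x)%N -> nth 0 s i <= nth 0 s j.
Proof.
move=> /andP[ij jx]; apply: (sorted_leq_nth le_trans le_refl) => //.
- exact: sort_le_sorted.
- by rewrite inE size_sort (leq_ltn_trans ij).
- by rewrite inE size_sort.
Qed.

(** The sorted positions from [m] on hold [size x - m] reports, each contributing at least [t]; the
    others contribute nonnegative amounts. *)
Lemma order_statistic_sum_upper : (forall z, nth 0 s m <= z -> t <= g z) ->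
  (size x - m)%:R * t <= \sum_(z <- x) g z.
Proof.
move=> tg; rewrite sum_sort -[leLHS]add0r lerD//; first exact: sumr_ge0.
rewrite mulr_natl -sumr_const_nat; apply: ler_sum_nat => i mi.
by apply: tg; exact: sorted_s.
Qed.

(** Positions are 0-based and position [m] itself counts, so [m.+1] reports contribute at least
    [t]. *)
Lemma order_statistic_sum_lower : (forall z, z <= nth 0 s m -> t <= g z) ->
  m.+1%:R * t <= \sum_(z <- x) g z.
Proof.
move=> tg; rewrite sum_sort (big_ltn mx)/= addrA -[leLHS]addr0 lerD//; last exact: sumr_ge0.
rewrite -natr1 mulrDl mul1r lerD//; last by apply: tg.
rewrite mulr_natl -[m in leLHS]subn0 -sumr_const_nat; apply: ler_sum_nat => i /andP[_ im].
by apply: tg; apply: sorted_s; rewrite (ltnW im).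
Qed.

End order_statistics.

(** * Truncation of the identity to an interval *)

Section clip.
Context {R : realType}.
Variables a b : R.
Hypothesis ab : a <= b.

Definition clip (z : R) := Num.min (Num.max z a) b.

Lemma clip_itv z : a <= clip z <= b.
Proof. by rewrite /clip le_min le_max ge_min !lexx ab !orbT. Qed.

Lemma clip_low z : z <= a -> clip z = a.
Proof. by move=> za; rewrite /clip max_r// min_l. Qed.

Lemma clip_high z : b <= z -> clip z = b.
Proof. by move=> bz; rewrite /clip max_l ?min_r//; exact: le_trans bz. Qed.

Lemma clip_lip1 : lip1 clip.
Proof.
move=> z z'; have := ler_norm (z - z'); have := ler_norm (z' - z).
rewrite (distrC z') ler_norml /clip => ? ?.
case: (leP z a) => ?; case: (leP z' a) => ?;
  rewrite !minEle; do ?(case: ifPn; rewrite -?ltNge => ?); apply/andP; split; lra.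
Qed.

End clip.

(** * Distribution function and quantiles *)

Section cdf_facts.
Context {R : realType}.
Variable mu : probability R R.
Local Notation F := (Defs.cdf mu).

Lemma measurable_le_set (x : R) : measurable [set y : R | y <= x].
Proof. by rewrite -set_itvNyc; exact: measurable_itv. Qed.

Lemma fine_mu_le (A B : set R) : measurable A -> measurable B -> A `<=` B ->
  fine (mu A) <= fine (mu B).
Proof.
move=> mA mB AB; apply: fine_le; [exact: fin_num_measure..|].
by apply: le_measure => //; exact/mem_set.
Qed.

Lemma cdf_homo (x y : R) : x <= y -> F x <= F y.
Proof.
move=> xy; apply: fine_mu_le; try exact: measurable_le_set.
by move=> z /= /le_trans; apply.
Qed.

(** The half-lines up to [- n] decrease to the empty set, so their measures tend to 0. *)
Lemma cdf_lt_ex (v : R) : 0 < v -> exists x, F x < v.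
Proof.
move=> v0; pose B n := [set y : R | y <= - n%:R].
have : mu (B n) @[n --> \oo] --> mu (\bigcap_n B n).
  apply: nonincreasing_cvg_mu => //.
  - by rewrite (le_lt_trans (probability_le1 _ _)) ?ltry//; exact: measurable_le_set.
  - by move=> n; exact: measurable_le_set.
  - by apply: bigcap_measurable => // n _; exact: measurable_le_set.
  - move=> m n mn; apply/subsetPset => y /= /le_trans; apply.
    by rewrite lerN2 ler_nat.
rewrite (_ : \bigcap_n B n = set0) ?measure0; last first.
  rewrite -subset0 => t /(_ (Num.truncn (- t)).+1 I).
  by rewrite /B/= leNgt => /negP; apply; rewrite ltrNl truncnS_gt.
move=> /fine_cvgP[_ /cvgrPdist_lt/(_ _ v0)[N _ /(_ N (leqnn N))]].
rewrite /= sub0r normrN => h; exists (- N%:R).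
exact: le_lt_trans (ler_norm _) h.
Qed.

(** The half-lines up to [n] increase to the whole line, so their measures tend to 1. *)
Lemma cdf_gt_ex (v : R) : v < 1 -> exists x, v < F x.
Proof.
move=> v1; pose B n := [set y : R | y <= n%:R].
have : mu (B n) @[n --> \oo] --> mu (\bigcup_n B n).
  apply: nondecreasing_cvg_mu => //.
  - by move=> n; exact: measurable_le_set.
  - by apply: bigcup_measurable => // n _; exact: measurable_le_set.
  - move=> m n mn; apply/subsetPset => y /= /le_trans; apply.
    by rewrite ler_nat.
rewrite (_ : \bigcup_n B n = setT) ?probability_setT; last first.
  by rewrite -subTset => t _; exists (Num.truncn t).+1 => //; exact/ltW/truncnS_gt.
have v1' : 0 < 1 - v by rewrite subr_gt0.
move=> /fine_cvgP[_ /cvgrPdist_lt/(_ _ v1')[N _ /(_ N (leqnn N))]].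
rewrite /= ltr_norml => h; exists N%:R.
have : 1 - F N%:R < 1 - v by case/andP: h.
by lra.
Qed.

(** Together with [quantile_set_neq0], this makes the real [inf] in [quantile] a genuine infimum
    instead of a default value. *)
Lemma quantile_set_lbound (v : R) : 0 < v -> has_lbound [set x : R | v <= F x].
Proof.
move=> /cdf_lt_ex[x Fx]; exists x => y /= vy; rewrite leNgt; apply/negP => yx.
by have := cdf_homo (ltW yx); lra.
Qed.

Lemma quantile_set_neq0 (v : R) : v < 1 -> [set x : R | v <= F x] !=set0.
Proof. by move=> /cdf_gt_ex[x /ltW vx]; exists x. Qed.

Lemma quantile_homo (v v' : R) : 0 < v -> v' < 1 -> v <= v' ->
  quantile mu v <= quantile mu v'.
Proof.
move=> v0 v1 vv'; apply: lb_le_inf; first exact: quantile_set_neq0.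
by move=> x /= v'x; apply: ge_inf; [exact: quantile_set_lbound|exact: le_trans v'x].
Qed.

Lemma cdf_quantileB (v e : R) : 0 < v -> 0 < e -> F (quantile mu v - e) < v.
Proof.
move=> v0 e0; rewrite ltNge; apply/negP => h.
have := ge_inf (quantile_set_lbound v0) h; rewrite -/(quantile mu v); lra.
Qed.

(** The inequality is weak because [F] could be flat above the quantile; [cdf_quantileD_gt] makes it
    strict by means of the density. *)
Lemma cdf_quantileD (v e : R) : v < 1 -> 0 < e -> v <= F (quantile mu v + e).
Proof.
move=> v1 e0; rewrite leNgt; apply/negP => h.
have : quantile mu v + e <= quantile mu v; last by lra.
apply: lb_le_inf; first exact: quantile_set_neq0.
move=> x /= vx; rewrite leNgt; apply/negP => xq.
by have := cdf_homo (ltW xq); lra.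
Qed.

Lemma Rintegral_le_indic (A : set R) (g : R -> R) (s : R) : measurable A ->
  mu.-integrable setT (EFin \o g) -> (forall x, g x <= s * \1_A x) ->
  \int[mu]_x g x <= s * fine (mu A).
Proof.
move=> mA ig gs.
have iA : mu.-integrable setT (EFin \o (\1_A : R -> R)) by exact: integrable_indic.
rewrite (@le_trans _ _ (\int[mu]_x (s * \1_A x)))//.
  by apply: le_Rintegral => //; exact: integrable_RZ.
by rewrite RintegralZl// Rintegral_indic.
Qed.

(** * Distance from an order statistic to a quantile *)

Section sample_quantile.
Hypothesis iid : mu.-integrable setT (EFin \o (id : R -> R)).
Variables (x : seq R) (v D : R).
Hypothesis x0 : (0 < size x)%N.
Hypothesis v01 : 0 < v < 1.
Hypothesis D0 : 0 <= D.
Hypothesis hD : forall g, lip1 g ->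
  `|(size x)%:R^-1 * (\sum_(z <- x) g z) - \int[mu]_z g z| <= D.

Local Notation m := `|Num.floor (((size x)%:R - 1) * v)|%N.
Local Notation xm := (nth 0 (sort <=%R x) m).

Let nR : 0 < (size x)%:R :> R. Proof. by rewrite ltr0n. Qed.

Let n1 : 0 <= (size x)%:R - 1 :> R. Proof. by rewrite subr_ge0 ler1n. Qed.

(** The floored number is nonnegative, since the sample is nonempty, so the absolute value in the
    index changes nothing. *)
Let m_itv : m%:R <= ((size x)%:R - 1) * v < m.+1%:R.
Proof.
case/andP: v01 => v0 v1.
have y0 : 0 <= ((size x)%:R - 1) * v by rewrite mulr_ge0// ltW.
by have := truncn_itv y0; rewrite truncn_floor y0.
Qed.

Let m_lt : (m < size x)%N.
Proof.
case/andP: v01 => v0 v1; case/andP: m_itv => h _.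
rewrite -(ltr_nat R) (le_lt_trans h)// (@le_lt_trans _ _ ((size x)%:R - 1))//.
  by rewrite ler_piMr// ltW.
by rewrite ltrBlDr ltrDl.
Qed.

(** The test function [g] rises from 0 at [q] to [s = xm - q] at [xm]. At least [size x - m] reports
    score [s], and [m <= (size x - 1) * v], so the average is at least [s * (1 - v)]; the integral
    is at most [s * (1 - F q)]. Their difference is at most [D]. *)
Lemma sample_quantile_upper (q : R) : v < F q -> xm - q <= D / (F q - v).
Proof.
move=> vq; have Fv : 0 < F q - v by rewrite subr_gt0.
have [xq|qx] := leP xm q.
  by rewrite (@le_trans _ _ 0) ?subr_le0// divr_ge0// ltW.
have qx' := ltW qx; set s := xm - q.
have s0 : 0 <= s by rewrite subr_ge0.
pose g z := clip q xm z - q.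
have lg : lip1 g by apply: lip1Bcst; exact: clip_lip1.
have g0 z : 0 <= g z by rewrite subr_ge0; case/andP: (clip_itv qx' z).
have S : (size x - m)%:R * s <= \sum_(z <- x) g z.
  by apply: order_statistic_sum_upper => // z xz; rewrite /g clip_high.
have I : \int[mu]_z g z <= s * (1 - F q).
  have -> : 1 - F q = fine (mu (~` [set y : R | y <= q])).
    rewrite probability_setC; last exact: measurable_le_set.
    by rewrite fineB// fin_num_measure//; exact: measurable_le_set.
  apply: Rintegral_le_indic; first by apply: measurableC; exact: measurable_le_set.
    exact: lip1_integrable.
  move=> z; rewrite indicE; have [zq|qz] := leP z q.
    by rewrite memNset/= ?mulr0; [rewrite /g clip_low ?subrr|move=> /(_ zq)].
  rewrite mem_set/=; last by apply/negP; rewrite -ltNge.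
  by rewrite mulr1 lerD2r; case/andP: (clip_itv qx' z).
have /ler_normlP[_ B] := hD lg.
have nS : s * (1 - v) <= (size x)%:R^-1 * \sum_(z <- x) g z.
  rewrite ler_pdivlMl//; apply: le_trans S.
  rewrite mulrCA mulrC ler_wpM2r// natrB 1?ltnW//.
  case/andP: v01 => v0 v1; case/andP: m_itv => h _.
  by move: h; rewrite mulrBl mul1r mulrBr mulr1; lra.
by rewrite ler_pdivlMr//; lra.
Qed.

(** The mirror argument: [m.+1] reports score [s = q - xm], while the integral is at most [s * F q].
    From [m.+1 > (size x - 1) * v] the fraction of such reports is only known to exceed
    [v - (size x)^-1], whence the correction. *)
Lemma sample_quantile_lower (q : R) : F q < v - (size x)%:R^-1 ->
  q - xm <= D / (v - (size x)%:R^-1 - F q).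
Proof.
move=> vq; have Fv : 0 < v - (size x)%:R^-1 - F q by rewrite subr_gt0.
have [xq|qx] := leP q xm.
  by rewrite (@le_trans _ _ 0) ?subr_le0// divr_ge0// ltW.
have qx' := ltW qx; set s := q - xm.
have s0 : 0 <= s by rewrite subr_ge0.
pose g z := q - clip xm q z.
have lg : lip1 g.
  by move=> z z'; rewrite /g opprB addrC addrA addrNK distrC; exact: clip_lip1.
have g0 z : 0 <= g z by rewrite subr_ge0; case/andP: (clip_itv qx' z).
have S : m.+1%:R * s <= \sum_(z <- x) g z.
  by apply: order_statistic_sum_lower => // z xz; rewrite /g clip_low.
have I : \int[mu]_z g z <= s * F q.
  apply: Rintegral_le_indic; first exact: measurable_le_set.
    exact: lip1_integrable.
  move=> z; rewrite indicE; have [zq|qz] := leP z q.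
    by rewrite mem_set// mulr1 lerD2l lerN2; case/andP: (clip_itv qx' z).
  rewrite memNset/= ?mulr0; last by apply/negP; rewrite -ltNge.
  by rewrite /g clip_high ?subrr// ltW.
have /ler_normlP[_ B] := hD lg.
have nS : s * (v - (size x)%:R^-1) <= (size x)%:R^-1 * \sum_(z <- x) g z.
  rewrite ler_pdivlMl//; apply: le_trans S.
  rewrite mulrCA mulrC ler_wpM2r// mulrBr mulfV ?gt_eqF//.
  case/andP: v01 => v0 v1; case/andP: m_itv => _ h.
  by move: h; rewrite mulrBl mul1r; lra.
by rewrite ler_pdivlMr//; lra.
Qed.

End sample_quantile.
End cdf_facts.

(** * Wasserstein distance to finitely supported measures *)

Section wasserstein.
Context {R : realType}.
Variable mu : probability R R.

Local Notation seqof y := [seq y j | j <- enum 'I__].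

Let size_seqof k (y : 'I_k -> R) : (0 < k)%N -> (0 < size (seqof y))%N.
Proof. by rewrite size_map size_enum_ord. Qed.

Let measurable_mindist k (y : 'I_k -> R) : (0 < k)%N ->
  measurable_fun setT (fun z : R => mindist z (seqof y)).
Proof. by move=> k0; apply: lip1_measurable; apply: mindist_lip1; exact: size_seqof. Qed.

(** Under any coupling the second coordinate almost surely lies among the points [y], so the cost
    dominates [mindist] of the first coordinate, whose law is [mu]. *)
Lemma W1_ge_mindist (k : nat) (w y : 'I_k -> R) (lam : set R -> \bar R) : (0 < k)%N ->
  (forall A, measurable A -> lam A = (\sum_(j < k) (w j)%:E * \d_(y j) A)%E) ->
  (\int[mu]_z (mindist z (seqof y))%:E <= W1 mu lam)%E.
Proof.
move=> k0 lamE; apply: le_ereal_inf_tmp => _ [pi Hpi <-].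
have my := measurable_mindist y k0.
(* [C] is the complement of the set of points [y]; [lam] does not charge it. *)
pose C := [set z : R | 0 < mindist z (seqof y)].
have mC : measurable C.
  rewrite (_ : C = (fun z => mindist z (seqof y)) @^-1` `]0, +oo[%classic).
    by rewrite -[X in measurable X]setTI; apply: my => //; exact: measurable_itv.
  by apply/seteqP; split => z /=; rewrite in_itv/= andbT.
have C0 : pi (setT `*` C) = 0%E.
  rewrite (Hpi C mC).2 lamE// big1// => j _; rewrite diracE memNset ?mule0// /C /=.
  apply/negP; rewrite -leNgt (le_trans (mindist_le (c := y j) _ _)) ?subrr ?normr0//.
  by rewrite map_f// mem_enum.
have -> : (\int[mu]_z (mindist z (seqof y))%:E = \int[pi]_z (mindist z.1 (seqof y))%:E)%E.
  apply/esym; apply: (@ge0_integral_law _ _ _ pi mu fst _ _ (fun z => (mindist z (seqof y))%:E)).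
  - exact: measurable_fst.
  - move=> A mA; rewrite -(Hpi A mA).1; congr (pi _).
    by apply/seteqP; split => [z Az|z []//].
  - exact/measurable_EFinP.
  - by move=> z; rewrite lee_fin mindist_ge0// size_seqof.
apply: ae_ge0_le_integral => //.
- by move=> z _; rewrite lee_fin mindist_ge0// size_seqof.
- apply/measurable_EFinP; apply: (measurableT_comp my); exact: measurable_fst.
- apply/measurable_EFinP; apply: measurableT_comp => //.
  by apply: measurable_funB; [exact: measurable_fst|exact: measurable_snd].
- exists (setT `*` C); split => //; first exact: measurableX.
  move=> z /= h; split => //; rewrite /C /= ltNge; apply/negP => m0; apply: h => _.
  have [c cy mc] := mindist_attained z.2 (size_seqof y k0).
  have /eqP : `|z.2 - c| = 0 by apply/eqP; rewrite eq_le normr_ge0 andbT -mc.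
  by rewrite normr_eq0 subr_eq0 => /eqP zc; rewrite lee_fin mindist_le// zc.
Qed.

(** The law of [z |-> (z, f z)] under [mu] is a coupling with exactly this cost. *)
Lemma W1_le_map (f : R -> R) (lam : set R -> \bar R) : measurable_fun setT f ->
  (forall A, measurable A -> lam A = mu (f @^-1` A)) ->
  (W1 mu lam <= \int[mu]_z (`|z - f z|)%:E)%E.
Proof.
move=> mf lamE.
have mh : measurable_fun setT (fun z : R => (z, f z)) by exact: measurable_fun_pair.
pose h : {mfun R >-> (R * R)%type} := HB.pack (fun z : R => (z, f z)) (isMeasurableFun.Build _ _ _ _ _ mh).
apply: ereal_inf_lbound; exists (distribution mu h).
  move=> A mA; split.
    by rewrite /= /distribution /pushforward; congr (mu _); apply/seteqP; split => [z []//|z Az].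
  rewrite lamE//= /distribution /pushforward; congr (mu _).
  by apply/seteqP; split => [z []//|z Az].
rewrite ge0_integral_distribution//.
apply/measurable_EFinP; apply: measurableT_comp => //.
by apply: measurable_funB; [exact: measurable_fst|exact: measurable_snd].
Qed.

(** * Transport along a partition into nearest-point cells *)

Section voronoi.
Variables (k : nat) (S : 'I_k -> set R) (y : 'I_k -> R).
Hypothesis k0 : (0 < k)%N.
Hypothesis mS : forall j, measurable (S j).
Hypothesis tS : forall i j z, S i z -> S j z -> i = j.
Hypothesis cS : mu [set z | ~ exists j, S j z] = 0%E.
Hypothesis dS : forall j z, S j z -> `|z - y j| = mindist z (seqof y).

Let U : set R := \big[setU/set0]_(j < k) S j.

Let UE : [set z | ~ exists j, S j z] = ~` U.
Proof.
rewrite /U -bigcup_seq; apply/seteqP; split => z /= h.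
  by move=> [j _ Sz]; apply: h; exists j.
by move=> [j Sz]; apply: h; exists j => //=; rewrite mem_index_enum.
Qed.

Let mU : measurable U. Proof. exact: bigsetU_measurable. Qed.

(** The transport map: it sends each cell to its point, and the uncovered null set to 0. *)
Let f (z : R) : R := \sum_(j < k) y j * \1_(S j) z.

Let fE j z : S j z -> f z = y j.
Proof.
move=> Sz; rewrite /f (bigD1 j)//= indicE mem_set// mulr1 big1 ?addr0// => i ij.
rewrite indicE memNset ?mulr0// => Siz.
by move/eqP: ij; apply; exact: tS Siz Sz.
Qed.

Let mf : measurable_fun setT f.
Proof.
by apply: measurable_sum => j; apply: measurable_funM.
Qed.

(** Up to a null set, the preimage of [A] is the disjoint union of the cells whose point lies in
    [A]. *)
Let law_f A : measurable A ->
  mu (f @^-1` A) = (\sum_(j < k) (fine (mu (S j)))%:E * \d_(y j) A)%E.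
Proof.
move=> mA; set B := f @^-1` A.
have mB : measurable B by rewrite -[X in measurable X]setTI; exact: mf.
have BE : B = (\big[setU/set0]_(j < k) (B `&` S j)) `|` (B `&` ~` U).
  apply/seteqP; split => z.
    move=> Bz; have [Uz|nUz] := pselect (U z); [left|by right].
    move: Uz; rewrite /U -!bigcup_seq => -[j _ Sz].
    by exists j => //=; rewrite mem_index_enum.
  by case=> [|[]//]; rewrite -bigcup_seq => -[j _ []].
have nU : mu (B `&` ~` U) = 0%E.
  apply: (subset_measure0 (B := ~` U)) => //.
  - by apply: measurableI => //; exact: measurableC.
  - exact: measurableC.
  - by rewrite -UE.
rewrite BE measureU0//; last 2 first.
- by apply: bigsetU_measurable => j _; exact: measurableI.
- by apply: measurableI => //; exact: measurableC.
rewrite measure_bigsetU_ord//; last 2 first.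
- by move=> j; exact: measurableI.
- by apply/trivIsetP => i j _ _ /eqP ij; rewrite -subset0 => z [[_ Si] [_ Sj]]; exact/ij/(tS Si Sj).
apply: eq_bigr => j _; rewrite fineK ?fin_num_measure// diracE.
have [yA|nyA] := boolP (y j \in A).
  rewrite mule1; congr (mu _); apply/seteqP; split => z; first by case.
  by move=> Sz; split => //; rewrite /B /= (fE Sz); exact: set_mem.
rewrite mule0 -[RHS](measure0 mu); congr (mu _); rewrite -subset0 => z [] + Sz.
by rewrite /B /= (fE Sz) => /mem_set; exact/negP.
Qed.

(** The lower bound [W1_ge_mindist] is attained by the map [f], for which [|z - f z|] equals
    [mindist] almost everywhere. *)
Lemma W1_voronoi (lam : set R -> \bar R) :
  (forall A, measurable A -> lam A = (\sum_(j < k) (fine (mu (S j)))%:E * \d_(y j) A)%E) ->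
  W1 mu lam = (\int[mu]_z (mindist z (seqof y))%:E)%E.
Proof.
move=> lamE; apply/eqP; rewrite eq_le (W1_ge_mindist k0 lamE) andbT.
have -> : (\int[mu]_z (mindist z (seqof y))%:E = \int[mu]_z (`|z - f z|)%:E)%E; last first.
  by apply: W1_le_map mf _ => A mA; rewrite lamE// law_f.
apply: ae_eq_integral => //.
- by apply/measurable_EFinP; exact: measurable_mindist.
- by apply/measurable_EFinP; apply: measurableT_comp => //; exact: measurable_funB.
- exists (~` U); split; [exact: measurableC|by rewrite -UE|].
  rewrite -UE => z /= h [j Sz]; apply: h => _.
  by rewrite (fE Sz) (dS Sz).
Qed.

Lemma in_Pk_voronoi :
  in_Pk k (fun A => \sum_(j < k) (fine (mu (S j)))%:E * \d_(y j) A)%E.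
Proof.
exists (fun j => fine (mu (S j))), y; split; first by move=> j; rewrite fine_ge0.
(* The weights add up to the mass of the whole line under the law of [f]. *)
split => //; apply: EFin_inj; rewrite -sumEFin -[RHS](probability_setT mu).
rewrite -(preimage_setT f) law_f//; apply: eq_bigr => j _.
by rewrite diracT mule1.
Qed.

End voronoi.

(** Ties are broken by the smallest index: the cell of [j] keeps the points nearest to [y j] that
    are not also nearest to some earlier [y i]. This makes the cells disjoint. *)
Lemma nearest_cells (k : nat) (y : 'I_k -> R) : (0 < k)%N ->
  exists S : 'I_k -> set R, [/\ forall j, measurable (S j),
    forall i j z, S i z -> S j z -> i = j, forall z, exists j, S j z &
    forall j z, S j z -> `|z - y j| = mindist z (seqof y)].
Proof.
move=> k0; have my := measurable_mindist y k0.
pose A (j : 'I_k) := [set z : R | `|z - y j| <= mindist z (seqof y)].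
have mA j : measurable (A j).
  rewrite (_ : A j = (fun z => mindist z (seqof y) - `|z - y j|) @^-1` `[0, +oo[%classic).
    have mg : measurable_fun setT (fun z => mindist z (seqof y) - `|z - y j|).
      apply: measurable_funB => //.
      by apply: measurableT_comp => //; exact: measurable_funB.
    by rewrite -[X in measurable X]setTI; apply: mg => //; exact: measurable_itv.
  by apply/seteqP; split => z /=; rewrite in_itv/= andbT subr_ge0.
exists (fun j => A j `&` \bigcap_(i in [set i : 'I_k | (i < j)%N]) ~` A i); split.
- move=> j; apply: measurableI => //; apply: fin_bigcap_measurable => // i _.
  exact: measurableC.
- move=> i j z [Ai hi] [Aj hj]; have [ij|ji|] := ltngtP i j; last exact: val_inj.
  + by case: (hj i ij).
  + by case: (hi j ji).
- move=> z; have [c /mapP[j _ ->] mc] := mindist_attained z (size_seqof y k0).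
  have Aj : `[< A j z >] by apply/asboolP; rewrite /A /= mc.
  case: (@arg_minnP _ j (fun i => `[< A i z >]) (fun i : 'I_k => i : nat) Aj) => i /asboolP Ai hi.
  exists i; split => // l /= li Al.
  by have := hi l (introT (asboolP _) Al); rewrite leqNgt li.
- move=> j z [Aj _]; apply/eqP; rewrite eq_le Aj/= mindist_le//.
  by rewrite map_f// mem_enum.
Qed.

(** The atoms of [nuk] serve as [x]. For any [y], the nearest-cell measure on [y] is a competitor
    whose cost is the integral of [mindist], so that integral bounds [W1 mu nuk] from above; at
    [y = x] it is also a lower bound. *)
Lemma W1_optimal (k : nat) (nuk : set R -> \bar R) : (0 < k)%N -> in_Pk k nuk ->
  (forall lam, in_Pk k lam -> (W1 mu nuk <= W1 mu lam)%E) ->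
  exists x : 'I_k -> R, W1 mu nuk = (\int[mu]_z (mindist z (seqof x))%:E)%E /\
    forall y : 'I_k -> R, (\int[mu]_z (mindist z (seqof x))%:E <=
      \int[mu]_z (mindist z (seqof y))%:E)%E.
Proof.
move=> k0 [w [x [_ [_ nukE]]]] opt; exists x.
have lo := W1_ge_mindist k0 nukE.
have up (y : 'I_k -> R) : (W1 mu nuk <= \int[mu]_z (mindist z (seqof y))%:E)%E.
  have [S [mS tS cS dS]] := nearest_cells y k0.
  have cS0 : mu [set z | ~ exists j, S j z] = 0%E.
    rewrite (_ : [set z | _] = set0) ?measure0// -subset0 => z /=; exact.
  rewrite -(W1_voronoi k0 mS tS cS0 dS (fun A _ => erefl)).
  by apply: opt; exact: in_Pk_voronoi.
split; first by apply/eqP; rewrite eq_le up lo.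
by move=> y; exact: le_trans (up y).
Qed.

End wasserstein.

(** * Consequences of the density being positive inside the support *)

Section support.
Context {R : realType}.
Variables (mu : probability R R) (rho : R -> R) (a b : \bar R).
Hypothesis rho0 : forall x, 0 <= rho x.
Hypothesis mrho : measurable_fun setT rho.
Hypothesis muE : forall A : set R, measurable A ->
  mu A = (\int[lebesgue_measure]_(x in A) (rho x)%:E)%E.
Hypothesis ab : (a < b)%E.
Hypothesis mu_out : mu [set x : R | ~ ((a <= x%:E)%E /\ (x%:E <= b)%E)] = 0%E.
Hypothesis rho_gt0 : forall x : R, (a < x%:E)%E -> (x%:E < b)%E -> 0 < rho x.
Local Notation F := (Defs.cdf mu).

Lemma mu_set1 (x : R) : mu [set x] = 0%E.
Proof. by rewrite muE ?integral_set1. Qed.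

Lemma measurable_lee_set (x : \bar R) : measurable [set y : R | (y%:E <= x)%E].
Proof.
case: x => [r| |].
- exact: measurable_le_set.
- by rewrite (_ : [set y | _] = setT)//; apply/seteqP; split => y //= _; rewrite leey.
- by rewrite (_ : [set y | _] = set0)//; apply/seteqP; split.
Qed.

Lemma measurable_gee_set (x : \bar R) : measurable [set y : R | (x <= y%:E)%E].
Proof.
case: x => [r| |].
- by rewrite -set_itvcy; exact: measurable_itv.
- by rewrite (_ : [set y | _] = set0)//; apply/seteqP; split.
- by rewrite (_ : [set y | _] = setT)//; apply/seteqP; split => y //= _; rewrite leNye.
Qed.

Let out := [set x : R | ~ ((a <= x%:E)%E /\ (x%:E <= b)%E)].

Let mout : measurable out.
Proof.
rewrite (_ : out = ~` ([set x : R | (a <= x%:E)%E] `&` [set x | (x%:E <= b)%E]))//.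
apply: measurableC; apply: measurableI; [exact: measurable_gee_set|exact: measurable_lee_set].
Qed.

Lemma mu_above : mu [set y : R | ~ (y%:E <= b)%E] = 0%E.
Proof.
apply: (subset_measure0 (B := out)) => //.
- by apply: (measurableC (A := [set y : R | (y%:E <= b)%E])); exact: measurable_lee_set.
- by move=> y /= yb [].
Qed.

(** The half-line contains [a], which the null set of the hypothesis does not; a finite [a] is added
    as a single point, null by absolute continuity. The first cell below is open at [a], so this set
    stays uncovered. *)
Lemma mu_below : mu [set y : R | (y%:E <= a)%E] = 0%E.
Proof.
have [[r ar _]|] : (exists2 r : R, a = r%:E & True) \/ a = -oo%E.
  by case: (a) ab => [r _|+|_]; [left; exists r|rewrite ltNge leey|right].
- have h0 : mu (out `|` [set r]) = 0%E by rewrite measureU0//; exact: mu_set1.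
  apply: (subset_measure0 _ _ _ h0).
  + exact: measurable_lee_set.
  + exact: measurableU.
  + move=> y /=; rewrite ar lee_fin le_eqVlt => /predU1P[->|yr]; [by right|left].
    by rewrite /out ar /= => -[]; rewrite lee_fin leNgt yr.
- by move=> ->; rewrite (_ : [set y | _] = set0) ?measure0//; apply/seteqP; split.
Qed.

(** A zero integral would force [rho = 0] almost everywhere on an interval of positive length where
    [rho] is positive. *)
Lemma mu_itv_gt0 (c e : R) : c < e -> (a <= c%:E)%E -> (e%:E <= b)%E ->
  (0 < mu `]c, e[%classic)%E.
Proof.
move=> ce ac eb; rewrite lt0e measure_ge0 andbT; apply/eqP.
rewrite muE// => I0.
have mr : measurable_fun `]c, e[ (EFin \o rho) by apply/measurable_EFinP; exact: measurable_funTS.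
have : (\int[lebesgue_measure]_(x in `]c, e[) `|(EFin \o rho) x| = 0)%E.
  by rewrite -I0; apply: eq_integral => x _; rewrite /= ger0_norm.
move=> /(ae_eq_integral_abs lebesgue_measure (measurable_itv _) mr)[N [mN N0 sN]].
have : (lebesgue_measure `]c, e[%classic = 0)%E.
  apply: (subset_measure0 (B := N)) => // x xce; apply: sN => /= /(_ xce) [] r0.
  move: xce; rewrite /= in_itv/= => /andP[cx xe].
  have : 0 < rho x.
    by apply: rho_gt0; [rewrite (le_lt_trans ac)|rewrite (lt_le_trans _ eb)]; rewrite ?lte_fin.
  by rewrite r0 ltxx.
rewrite lebesgue_measure_itv/= lte_fin ce -EFinB => -[].
by move/eqP; rewrite subr_eq0 gt_eqF.
Qed.

Lemma quantile_ge_inf (v : R) : 0 < v < 1 -> (a <= (quantile mu v)%:E)%E.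
Proof.
move=> /andP[v0 v1]; case E : a => [r| |]; [|by move: ab; rewrite E ltNge leey|by rewrite leNye].
rewrite lee_fin; apply: lb_le_inf; first exact: quantile_set_neq0.
move=> x /= vx; rewrite leNgt; apply/negP => xr.
have : F x <= fine (mu [set y : R | (y%:E <= a)%E]).
  apply: fine_mu_le; [exact: measurable_le_set|exact: measurable_lee_set|].
  by move=> y /= yx; rewrite E lee_fin (le_trans yx)// ltW.
by rewrite mu_below/=; lra.
Qed.

Lemma cdf_above (x : R) : (b <= x%:E)%E -> F x = 1.
Proof.
move=> bx; have mx := measurable_le_set x.
have : mu (~` [set y : R | y <= x]) = 0%E.
  apply: (subset_measure0 (B := [set y : R | ~ (y%:E <= b)%E])); last exact: mu_above.
  - exact: measurableC.
  - by apply: (measurableC (A := [set y : R | (y%:E <= b)%E])); exact: measurable_lee_set.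
  - by move=> y /= yx yb; apply: yx; rewrite -lee_fin (le_trans yb).
rewrite probability_setC// -[mu _]fineK ?fin_num_measure// -EFinB => -[].
by move/eqP; rewrite subr_eq0 => /eqP/esym.
Qed.

Lemma quantile_le_sup (v : R) : 0 < v < 1 -> ((quantile mu v)%:E <= b)%E.
Proof.
move=> /andP[v0 v1]; case E : b => [r| |]; [|by rewrite leey|by move: ab; rewrite E ltNge leNye].
rewrite lee_fin; apply: ge_inf; first exact: quantile_set_lbound.
by rewrite /= cdf_above ?E// ltW.
Qed.

(** The weak inequality holds already at [q + e / 2]. Beyond that point either [F] has reached 1 or
    an interval inside the support adds positive mass. *)
Lemma cdf_quantileD_gt (v e : R) : 0 < v < 1 -> 0 < e -> v < F (quantile mu v + e).
Proof.
move=> v01 e0; have /andP[v0 v1] := v01; set q := quantile mu v.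
have e20 : 0 < e / 2 by rewrite divr_gt0.
have vq := cdf_quantileD mu v1 e20; rewrite -/q in vq.
have qq : q + e / 2 < q + e by lra.
have [bq|qb] := leP b (q + e / 2)%:E.
  by rewrite cdf_above// (le_trans bq)// lee_fin ltW.
(* [f] is the smaller of [q + e] and [b]. *)
have [f [qf fe fb]] : exists f : R, [/\ q + e / 2 < f, f <= q + e & (f%:E <= b)%E].
  have [eb|be] := leP (q + e)%:E b; first by exists (q + e).
  case E : b => [r| |]; [|by move: be; rewrite E ltNge leey|by move: qb; rewrite E].
  by exists r; rewrite E !lte_fin in qb be *; split => //; exact: ltW.
have aq : (a <= (q + e / 2)%:E)%E.
  by rewrite (le_trans (quantile_ge_inf v01))// lee_fin lerDl ltW.
have pos := mu_itv_gt0 qf aq fb.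
have : F (q + e / 2) + fine (mu `]q + e / 2, f[%classic) <= F (q + e).
  rewrite -fineD ?fin_num_measure//; [|exact: measurable_le_set].
  rewrite -measureU//; [|exact: measurable_le_set|].
    apply: fine_mu_le; [by apply: measurableU => //; exact: measurable_le_set|exact: measurable_le_set|].
    move=> y /= [yq|]; first by rewrite (le_trans yq)// ltW.
    by rewrite in_itv/= => /andP[_ yf]; rewrite ltW// (lt_le_trans yf).
  rewrite -subset0 => y /= [yq]; rewrite in_itv/= => /andP[]; lra.
have : 0 < fine (mu `]q + e / 2, f[%classic).
  by rewrite fine_gt0// pos (le_lt_trans (probability_le1 _ _)) ?ltry.
lra.
Qed.

(** * The measure carried by the quantiles *)

Section nuQ.
Variables (k : nat) (v : 'I_k -> R).
Hypothesis k0 : (0 < k)%N.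
Hypothesis pv : percentile_vector v.

(** [q] and [z] repeat the local definitions inside [nuQ]; the default 0 occurs only at indices
    outside the range of [v]. *)
Let q (m : nat) : R := if insub m is Some i then quantile mu (v i) else 0.
Let z (m : nat) : \bar R :=
  if m == 0%N then a else if (k <= m)%N then b else ((q m.-1 + q m) / 2)%:E.

Let qE (j : 'I_k) : q j = quantile mu (v j).
Proof. by rewrite /q valK. Qed.

Let q_itv m : (m < k)%N -> ((a <= (q m)%:E) && ((q m)%:E <= b))%E.
Proof.
move=> mk; rewrite (qE (Ordinal mk)).
by rewrite quantile_ge_inf ?quantile_le_sup//; exact: pv.1.
Qed.

Let q_homo i j : (i <= j)%N -> (j < k)%N -> q i <= q j.
Proof.
move=> ij jk; rewrite (qE (Ordinal jk)) (qE (Ordinal (leq_ltn_trans ij jk))).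
apply: quantile_homo.
- by case/andP: (pv.1 (Ordinal (leq_ltn_trans ij jk))).
- by case/andP: (pv.1 (Ordinal jk)).
- exact: pv.2.
Qed.

Let z_mid m : (0 < m)%N -> (m < k)%N -> z m = ((q m.-1 + q m) / 2)%:E.
Proof. by move=> m0 mk; rewrite /z (gtn_eqF m0) leqNgt mk. Qed.

Let zk : z k = b.
Proof. by rewrite /z (gtn_eqF k0) leqnn. Qed.

Let z_step m : (m < k)%N -> (z m <= z m.+1)%E.
Proof.
move=> mk; have [->|m0] := posnP m.
  have [k1|k1] := leqP k 1; first by rewrite /z /= k1 ltW.
  rewrite (@z_mid 1)// /z/=; have /andP[h0 _] := q_itv k0; have /andP[h1 _] := q_itv k1.
  by case: (a) h0 h1 => [r| |]; [rewrite !lee_fin; lra|by rewrite leye_eq => /eqP|by move=> *; rewrite leNye].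
rewrite (@z_mid m)//; have m1k : (m.-1 < k)%N by exact: leq_ltn_trans (leq_pred _) mk.
have [km|mk1] := leqP k m.+1.
  rewrite /z /= km; have /andP[_ h0] := q_itv m1k; have /andP[_ h1] := q_itv mk.
  by case: (b) h0 h1 => [r| |]; [rewrite !lee_fin; lra|by move=> *; rewrite leey|by rewrite leeNy_eq => /eqP].
rewrite (@z_mid m.+1)//= lee_fin; have := q_homo (leq_pred m) mk; have := q_homo (leqnSn m) mk1; lra.
Qed.

Let z_homo i j : (i <= j)%N -> (j <= k)%N -> (z i <= z j)%E.
Proof.
elim: j => [|j IH]; first by rewrite leqn0 => /eqP ->.
rewrite leq_eqVlt => /predU1P[->//|]; rewrite ltnS => ij jk.
by rewrite (le_trans (IH ij (ltnW jk)))// z_step.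
Qed.

(** Half-open cells are disjoint even when quantiles coincide, and their masses are exactly the
    differences of [cdf_ext] in [nuQ]. *)
Let S (j : 'I_k) := [set x : R | (z j < x%:E)%E /\ (x%:E <= z j.+1)%E].

Let SE j : S j = [set x : R | (x%:E <= z j.+1)%E] `\` [set x : R | (x%:E <= z j)%E].
Proof.
apply/seteqP; split => x /= [h1 h2]; split => //; first by apply/negP; rewrite -ltNge.
by rewrite ltNge; apply/negP.
Qed.

Let mS j : measurable (S j).
Proof. by rewrite SE; apply: measurableD; exact: measurable_lee_set. Qed.

(** The cells are cut at the midpoints of consecutive sorted quantiles, so on each cell its own
    quantile is a nearest one and [W1_voronoi] applies. *)
Lemma W1_nuQ : W1 mu (nuQ mu a b v) =
  (\int[mu]_x (mindist x [seq quantile mu (v j) | j <- enum 'I_k])%:E)%E.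
Proof.
apply: (W1_voronoi (S := S)) => //.
- move=> i j x [zi xi] [zj xj]; have [ij|ij|] := ltngtP i j; last exact: val_inj.
    by have := le_lt_trans (le_trans xi (z_homo ij (ltnW (ltn_ord j)))) zj; rewrite ltxx.
  by have := le_lt_trans (le_trans xj (z_homo ij (ltnW (ltn_ord i)))) zi; rewrite ltxx.
- have null : mu ([set y : R | (y%:E <= a)%E] `|` [set y : R | ~ (y%:E <= b)%E]) = 0%E.
    rewrite measureU0; [exact: mu_below|exact: measurable_lee_set| |exact: mu_above].
    by apply: (measurableC (A := [set y : R | (y%:E <= b)%E])); exact: measurable_lee_set.
  apply: (subset_measure0 _ _ _ null).
  + rewrite (_ : [set x | _] = ~` \big[setU/set0]_(j < k) S j).
      by apply: measurableC; apply: bigsetU_measurable.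
    rewrite -bigcup_seq; apply/seteqP; split => x /= h.
      by move=> [j _ Sx]; apply: h; exists j.
    by move=> [j Sx]; apply: h; exists j => //=; rewrite mem_index_enum.
  + apply: measurableU; first exact: measurable_lee_set.
    by apply: (measurableC (A := [set y : R | (y%:E <= b)%E])); exact: measurable_lee_set.
  + move=> x /= nS; have [xa|ax] := leP x%:E a; first by left.
    right => xb; apply: nS.
    (* The first [m] with [x <= z m] is positive, because [z 0 = a < x], and places [x] in cell
       [m.-1]. *)
    have exm : exists m, (x%:E <= z m)%E by exists k; rewrite zk.
    case: (ex_minnP exm) => m xm hm.
    have m0 : (0 < m)%N by rewrite lt0n; apply/eqP => m0; move: xm; rewrite m0 /z/= leNgt ax.
    have mk : (m.-1 < k)%N by rewrite prednK//; apply: hm; rewrite zk.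
    exists (Ordinal mk); split; rewrite /= ?prednK// ltNge; apply/negP => /hm.
    by rewrite leqNgt prednK// leqnn.
- move=> j x [zx xz]; apply/eqP; rewrite eq_le; apply/andP; split; last first.
    by apply: mindist_le; apply/mapP; exists j; rewrite ?mem_enum.
  have [|c /mapP[i _ ->] ->] := @mindist_attained _ x [seq quantile mu (v j) | j <- enum 'I_k].
    by rewrite size_map size_enum_ord.
  rewrite -!qE; have [ij|ji|/val_inj ->//] := ltngtP i j.
    (* Here [q i <= q j.-1 <= q j] and [x] is right of the midpoint of the last two, so [q j] is at
       least as near as [q i]. The case [j < i] is symmetric. *)
    have j0 : (0 < j)%N by exact: leq_ltn_trans ij.
    rewrite z_mid// lte_fin in zx.
    have h1 : q i <= q j.-1.
      by apply: q_homo; [rewrite -ltnS prednK|exact: leq_ltn_trans (leq_pred _) (ltn_ord j)].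
    have h2 := q_homo (leq_pred j) (ltn_ord j).
    rewrite (@ger0_norm _ (x - q i)); last by lra.
    by rewrite ler_norml; apply/andP; split; lra.
  have jk : (j.+1 < k)%N by exact: leq_ltn_trans (ltn_ord i).
  rewrite z_mid// lee_fin/= in xz.
  have h1 := q_homo ji (ltn_ord i).
  have h2 := q_homo (leqnSn j) jk.
  rewrite (@ler0_norm _ (x - q i)); last by lra.
  by rewrite ler_norml; apply/andP; split; lra.
- move=> A mA; rewrite /nuQ; apply: eq_bigr => j _; rewrite -[quantile mu (v j)]qE.
  congr (_%:E * _)%E; rewrite SE measureD; last 3 first.
  + exact: measurable_lee_set.
  + exact: measurable_lee_set.
  + by rewrite (le_lt_trans (probability_le1 _ _)) ?ltry//; exact: measurable_lee_set.
  rewrite setIidr; last by move=> y /= /le_trans; apply; exact: z_step.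
  by rewrite fineB//; apply: fin_num_measure; exact: measurable_lee_set.
Qed.

End nuQ.
End support.

(** * Bounds on the social cost and positivity of its limit *)

Section social_cost.
Context {R : realType}.
Implicit Types (x y : seq R).

Lemma SC_ge0 x y : (0 < size y)%N -> 0 <= SC x y.
Proof.
by move=> y0; rewrite /SC mulr_ge0 ?invr_ge0// sumr_ge0// => z _; exact: mindist_ge0.
Qed.

Lemma SC_dist_le (k : nat) (f f' : 'I_k -> R) x : (0 < k)%N ->
  `|SC x [seq f j | j <- enum 'I_k] - SC x [seq f' j | j <- enum 'I_k]| <=
  \sum_(j < k) `|f j - f' j|.
Proof.
move=> k0; rewrite /SC -mulrBr -sumrB normrM ger0_norm ?invr_ge0//.
(* On the empty sample the factor is [0^-1 = 0]. *)
have [->|x0] := posnP (size x); first by rewrite invr0 mul0r sumr_ge0.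
rewrite ler_pdivrMl ?ltr0n// (le_trans (ler_norm_sum _ _ _))//.
rewrite (le_trans (ler_sum _ (fun z _ => mindist_dist_le f f' z k0)))//.
by rewrite big_const_seq count_predT iter_addr_0 mulr_natl.
Qed.

Lemma SC_opt_le k x y : (0 < k)%N -> size y = k -> SC_opt k x <= SC x y.
Proof.
move=> k0 yk; apply: ge_inf; last by exists y.
by exists 0 => _ [y' /= y'k <-]; rewrite SC_ge0// y'k.
Qed.

Lemma SC_opt_ge k x (c : R) : (forall y, size y = k -> c <= SC x y) -> c <= SC_opt k x.
Proof.
move=> h; apply: lb_le_inf; last by move=> _ [y /= yk <-]; exact: h.
by exists (SC x (nseq k 0)); exists (nseq k 0) => //=; rewrite size_nseq.
Qed.

Lemma seq_enum_ordE k y : size y = k -> y = [seq nth 0 y (j : 'I_k) | j <- enum 'I_k].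
Proof.
move=> yk; apply: (@eq_from_nth _ 0); first by rewrite size_map size_enum_ord.
move=> i; rewrite yk => ik.
by rewrite (nth_map (Ordinal ik)) ?size_enum_ord// nth_enum_ord.
Qed.

(** A zero integral would concentrate [mu] on [k] points, each of measure 0. This keeps the limit of
    the denominator away from 0. *)
Lemma Rintegral_mindist_gt0 (mu : probability R R) k (y : 'I_k -> R) : (0 < k)%N ->
  mu.-integrable setT (EFin \o (id : R -> R)) -> (forall z : R, mu [set z] = 0%E) ->
  0 < \int[mu]_z mindist z [seq y j | j <- enum 'I_k].
Proof.
move=> k0 iid mu1.
have y0 : (0 < size [seq y j | j <- enum 'I_k])%N by rewrite size_map size_enum_ord.
have im := lip1_integrable iid (mindist_lip1 y0).
rewrite lt0r Rintegral_ge0 ?andbT; last by move=> z _; exact: mindist_ge0.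
apply/eqP => I0.
have : (\int[mu]_z `|(mindist z [seq y j | j <- enum 'I_k])%:E| = 0)%E.
  under eq_integral do rewrite gee0_abs ?lee_fin ?mindist_ge0//.
  by rewrite -[LHS]fineK; [rewrite -[RHS]/(0%:E) -I0|exact: integrable_fin_num im].
move=> /(ae_eq_integral_abs mu measurableT (measurable_int _ im))[N [mN N0 sN]].
pose B : set R := \big[setU/set0]_(j < k) [set y j].
have [mB B0] : measurable B /\ mu B = 0%E.
  rewrite /B; elim/big_ind : _ => [|A C [mA A0] [mC C0]|j _].
  - by split; [exact: measurable0|exact: measure0].
  - by split; [exact: measurableU|rewrite measureU0].
  - by split; [exact: measurable_set1|exact: mu1].
have : mu (N `|` B) = 0%E by rewrite measureU0.
rewrite (_ : N `|` B = setT).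
  by rewrite probability_setT => /eqP; rewrite onee_eq0.
apply/seteqP; split => // z _; have [zN|zN] := pselect (N z); [by left|right].
have m0 : mindist z [seq y j | j <- enum 'I_k] = 0.
  apply: contrapT => mz; apply/zN/sN => /= /(_ I) h; apply: mz; exact: EFin_inj h.
have [c /mapP[j _ ->] mc] := mindist_attained z y0.
rewrite /B -bigcup_seq; exists j; first by rewrite /= mem_index_enum.
by move/esym/eqP: mc; rewrite m0 normr_eq0 subr_eq0 => /eqP.
Qed.

End social_cost.

(** * Limit of the ratio of expected costs *)

Theorem theorem3 (R : realType)
  (mu : probability R R) (rho : R -> R) (a b : \bar R)
  (k : nat) (v : 'I_k -> R)
  (d : measure_display) (T : measurableType d) (P : probability T R)
  (X : forall n : nat, 'I_n -> T -> R)
  (nuk : set R -> \bar R) :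
  (* standing assumptions: density, support interval I = [a,b] (in R), *)
  (forall x, 0 <= rho x) ->
  measurable_fun setT rho ->
  (forall A : set R, measurable A ->
      mu A = (\int[lebesgue_measure]_(x in A) (rho x)%:E)%E) ->
  (a < b)%E ->
  mu [set x : R | ~ ((a <= x%:E)%E /\ (x%:E <= b)%E)] = 0%E ->
  (forall x : R, (a < x%:E)%E -> (x%:E < b)%E -> 0 < rho x) ->
  derivable_on rho [set x : R | (a <= x%:E)%E /\ (x%:E <= b)%E] ->
  (* finite first moment *)
  (\int[mu]_x (`|x|)%:E < +oo)%E ->
  (* percentile vector *)
  (0 < k)%N ->
  percentile_vector v ->
  (* X n is a vector of n i.i.d. random variables with law mu *)
  (forall n (i : 'I_n), measurable_fun setT (X n i)) ->
  (forall n (i : 'I_n) (A : set R), measurable A ->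
      P (X n i @^-1` A) = mu A) ->
  (forall n (B : 'I_n -> set R), (forall i, measurable (B i)) ->
      fine (P (\bigcap_(i in [set: 'I_n]) (X n i @^-1` B i))) =
      \prod_(i < n) fine (P (X n i @^-1` B i))) ->
  (* nu^(k) is a solution of min_{lam in P_k(R)} W1(mu, lam) *)
  in_Pk k nuk ->
  (forall lam, in_Pk k lam -> (W1 mu nuk <= W1 mu lam)%E) ->
  (fun n : nat =>
     fine (\int[P]_w (SC_v v [seq X n i w | i <- enum 'I_n])%:E)%E /
     fine (\int[P]_w (SC_opt k [seq X n i w | i <- enum 'I_n])%:E)%E)
    @ \oo --> fine (W1 mu (nuQ mu a b v)) / fine (W1 mu nuk).
Proof.
move=> rho0 mrho muE ab mu_out rho_gt0 _ mom k0 pv mX lX indX nukPk nukopt.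
have iid : mu.-integrable setT (EFin \o (id : R -> R)).
  by apply/integrableP; split => //; apply/measurable_EFinP.
have size_enum (y : 'I_k -> R) : (0 < size [seq y j | j <- enum 'I_k])%N.
  by rewrite size_map size_enum_ord.
have lmd (y : 'I_k -> R) := mindist_lip1 (size_enum y).
have imd (y : 'I_k -> R) := lip1_integrable iid (lmd y).
have [xs [nukE optxs]] := W1_optimal k0 nukPk nukopt.
pose Q j := quantile mu (v j).
pose L (y : 'I_k -> R) := \int[mu]_z mindist z [seq y j | j <- enum 'I_k].
have L0 y : 0 <= L y by apply: Rintegral_ge0 => z _; exact: mindist_ge0.
have Lmin y : L xs <= L y.
  by apply: fine_le; [exact: integrable_fin_num (imd _)..|exact: optxs].
have -> : fine (W1 mu (nuQ mu a b v)) = L Q.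
  by rewrite (W1_nuQ muE ab mu_out k0 pv).
have -> : fine (W1 mu nuk) = L xs by rewrite nukE.
have sumX n w (g : R -> R) :
    \sum_(z <- [seq X n i w | i <- enum 'I_n]) g z = \sum_(i < n) g (X n i w).
  by rewrite big_map big_enum.
have sizeX n w : size [seq X n i w | i <- enum 'I_n] = n.
  by rewrite size_map size_enum_ord.
have ulln := uniform_lln_lip1 iid mX lX indX.
have Lpos : 0 < L xs by apply: Rintegral_mindist_gt0 => // x; exact: mu_set1 muE x.
apply: cvgM; last apply: cvgV; first 1 last.
- by rewrite gt_eqF.
(* Denominator: the cost is within [D] of [L] for all facility positions at once, so its infimum is
   within [D] of the minimum [L xs]. *)
- apply: cvg_expectation_squeeze => // [n w|e e0].
    by apply: SC_opt_ge => y yk; rewrite SC_ge0// yk.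
  have [N hN] := ulln e e0; exists N => n Nn.
  have [D [D0 iD De hD]] := hN n Nn; exists D; split => // w.
  have h (y : 'I_k -> R) : `|SC [seq X n i w | i <- enum 'I_n] [seq y j | j <- enum 'I_k] - L y| <= D w.
    by rewrite /SC sizeX sumX; exact: hD.
  rewrite ler_norml; apply/andP; split.
    rewrite lerBrDr; apply: SC_opt_ge => y yk; rewrite (seq_enum_ordE yk).
    set y' := fun j : 'I_k => nth 0 y j.
    by have := h y'; rewrite ler_norml => /andP[+ _]; have := Lmin y'; lra.
  rewrite lerBlDr (le_trans (SC_opt_le (y := [seq xs j | j <- enum 'I_k]) _ k0 _))//.
    by rewrite size_map size_enum_ord.
  by have := h xs; rewrite ler_norml => /andP[_]; lra.
(* Numerator: the order statistics [M] are compared with the quantiles [Q], then the cost at [Q]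
   with [L Q]. *)
- apply: cvg_expectation_squeeze => // [n w|e e0]; first exact: SC_ge0 (size_enum _).
  (* Summed over the [k] facilities, [eps] uses up [e / 2]; the other half is left for the mean of
     [C * D]. *)
  pose eps := e / (2 * k%:R).
  have kR : 0 < k%:R :> R by rewrite ltr0n.
  have eps0 : 0 < eps by rewrite divr_gt0// mulr_gt0.
  (* A lower bound on how far [F] at [Q j + eps] and [Q j - eps] is from [v j]. The half on the left
     side absorbs the [n^-1] of [sample_quantile_lower] as soon as [n^-1 <= c j]. *)
  pose c j := Num.min (Defs.cdf mu (Q j + eps) - v j) ((v j - Defs.cdf mu (Q j - eps)) / 2).
  have c0 j : 0 < c j.
    rewrite lt_min subr_gt0 (cdf_quantileD_gt rho0 mrho muE ab mu_out rho_gt0 (pv.1 j) eps0)/=.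
    by rewrite divr_gt0// subr_gt0 cdf_quantileB//; case/andP: (pv.1 j).
  (* The 1 pays for the deviation of the cost at [Q], the sum for the [k] order statistics. Since
     [C] dominates each [(c j)^-1], [n >= C] gives [n^-1 <= c j]. *)
  pose C := 1 + \sum_(j < k) (c j)^-1.
  have cV0 j : 0 <= (c j)^-1 by rewrite invr_ge0 ltW.
  have C1 : 1 <= C by rewrite lerDl sumr_ge0.
  have C0 : 0 < C by exact: lt_le_trans C1.
  have cC j : (c j)^-1 <= C.
    by rewrite /C (bigD1 j)//= addrCA lerDl addr_ge0// sumr_ge0.
  have eC : 0 < e / (2 * C) by rewrite divr_gt0// mulr_gt0.
  have [N hN] := ulln _ eC; exists (maxn N (Num.truncn C).+1) => n.
  rewrite geq_max => /andP[Nn Cn].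
  have nC : C <= n%:R by rewrite (le_trans (ltW (truncnS_gt _)))// ler_nat.
  have n0 : (0 < n)%N by exact: leq_ltn_trans Cn.
  have nR : 0 < n%:R :> R by rewrite ltr0n.
  have nc j : n%:R^-1 <= c j.
    by rewrite -[c j]invrK lef_pV2 ?posrE ?invr_gt0// (le_trans (cC j)).
  have [D [D0 iD De hD]] := hN n Nn.
  have iCD : P.-integrable setT (EFin \o (fun w => C * D w)) by exact: integrable_RZ.
  exists (fun w => e / 2 + C * D w); split.
  + by move=> w; rewrite addr_ge0 ?mulr_ge0 ?divr_ge0// ltW.
  + by apply: integrable_RD => //; exact: integrable_cst.
  + rewrite RintegralD//; last exact: integrable_cst.
    rewrite Rintegral_prob_cst RintegralZl//.
    have : C * \int[P]_w D w <= C * (e / (2 * C)) by rewrite ler_wpM2l// ltW.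
    rewrite (_ : C * (e / (2 * C)) = e / 2); first by lra.
    by rewrite invfM mulrC -!mulrA mulVf ?gt_eqF// mulr1.
  + move=> w; set x := [seq X n i w | i <- enum 'I_n].
    have hx g : lip1 g -> `|(size x)%:R^-1 * (\sum_(z <- x) g z) - \int[mu]_z g z| <= D w.
      by rewrite sizeX sumX; exact: hD.
    have x0 : (0 < size x)%N by rewrite sizeX.
    pose M j := nth 0 (sort <=%R x) `|Num.floor (((size x)%:R - 1) * v j)|%N.
    have MQ j : `|M j - Q j| <= eps + D w * (c j)^-1.
      have ge c' : c j <= c' -> D w / c' <= D w * (c j)^-1.
        by move=> cc'; rewrite ler_wpM2l// lef_pV2 ?posrE// (lt_le_trans _ cc').
      have c1 : c j <= Defs.cdf mu (Q j + eps) - v j by rewrite ge_min lexx.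
      have c2 : c j <= v j - (size x)%:R^-1 - Defs.cdf mu (Q j - eps).
        have : c j <= (v j - Defs.cdf mu (Q j - eps)) / 2 by rewrite ge_min lexx orbT.
        by rewrite sizeX; have := nc j; lra.
      have up := sample_quantile_upper iid x0 (pv.1 j) (D0 w) hx (q := Q j + eps).
      have lo := sample_quantile_lower iid x0 (pv.1 j) (D0 w) hx (q := Q j - eps).
      have {}up := le_trans (up (_ : _)) (ge _ c1).
      have {}lo := le_trans (lo (_ : _)) (ge _ c2).
      have v1 : v j < Defs.cdf mu (Q j + eps) by have := c0 j; lra.
      have v2 : Defs.cdf mu (Q j - eps) < v j - (size x)%:R^-1 by have := c0 j; lra.
      have {}up := up v1; have {}lo := lo v2.
      rewrite -/(M j) in up lo.
      by rewrite ler_norml; apply/andP; split; lra.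
    have S1 := SC_dist_le M Q x k0.
    have S2 : \sum_(j < k) `|M j - Q j| <= e / 2 + D w * \sum_(j < k) (c j)^-1.
      rewrite (le_trans (ler_sum _ (fun j _ => MQ j)))// big_split/= mulr_sumr lerD2r.
      rewrite sumr_const card_ord /eps -[X in X <= _]mulr_natr.
      by rewrite invfM -!mulrA mulVf ?gt_eqF// mulr1.
    have S3 := hx _ (lmd Q); rewrite -/(L Q) -/(SC x _) in S3.
    rewrite /SC_v -/(PM v x) (_ : PM v x = [seq M j | j <- enum 'I_k])//.
    move: S1 S3; rewrite !ler_norml => /andP[? ?] /andP[? ?].
    rewrite /C mulrDl mul1r [_ * D w]mulrC.
    by apply/andP; split; lra.
Qed.
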